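(* Let $A_1=P_1J_1P_1^{-1}$ with $J_1=\begin{pmatrix}-n_1&1\\0&-n_1\end{pmatrix}$, $n_1>0$, and $A_2=P_2J_2P_2^{-1}$ with $J_2=\mathrm{diag}(p_2,q_2)$, where either $0<p_2\le q_2$ or $p_2\le0<q_2$; here $P_1,P_2$ are real invertible $2\times 2$ matrices chosen such that $M=P_2^{-1}P_1=\begin{pmatrix}a&b\\c&d\end{pmatrix}$ has determinant $1$. Let $\eta>0$ be given. (i) Let $0<p_2=q_2$. If $ac\ne0$, let $\tau_{2,1}(\eta)$ be the unique positive solution $t$ of $q_2\eta=n_1t-\sinh^{-1}(|ac|\,t)$; otherwise let $\tau_{2,1}(\eta)=\frac{q_2}{n_1}\eta+\epsilon_0$, for any $\epsilon_0>0$. (ii) Let $p_2\ne q_2$, and put $\tilde p_2=\max\{0,p_2\}$, $\mu=\frac{q_2-\tilde p_2}{2}$, $\nu=\frac{q_2+\tilde p_2}{2}$. (a) If $ac=0$, let $\tau_{2,1}(\eta)=\frac{q_2}{n_1}\eta+\epsilon_0$, for any $\epsilon_0>0$. (b) If $ac\notin(-n_1,0]$, let $\tau_{2,1}(\eta)$ be the unique positive solution $t$ of $$ac\,t\cosh(\mu\eta)=-\sinh(\mu\eta)+\mathrm{sgn}(ac)\,\sinh(n_1t-\nu\eta).$$ (c) If $ac\in(-n_1,0)$, let $\tau_{2,1}(\eta)=\max\{\tau_+(\eta),\tau_-(\eta)\}$, where $\tau_+(\eta)$ and $\tau_-(\eta)$ are the unique positive solutions $t$ of, respectively, $$ac\,t\cosh(\mu\eta)=-\sinh(\mu\eta)+\sinh(n_1t-\nu\eta)\quad\text{and}\quad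 -n_1t\cosh(\mu\eta)=-\sinh(\mu\eta)-\sinh(n_1t-\nu\eta).$$ Then the switched system $\dot x(t)=A_{\sigma(t)}x(t)$ is stable for all $\sigma\in\mathcal S[\tau_{2,1}(\eta),\eta]$ and asymptotically stable for all $\sigma\in\mathcal S'[\tau_{2,1}(\eta),\eta]$.
   Context: Planar switched system: $\dot x(t)=A_{\sigma(t)}x(t)$, $x(t)\in\mathbb R^2$ continuous in $t\ge0$, with $A_1,A_2$ real $2\times2$ matrices. A switching signal $\sigma:[0,\infty)\to\{1,2\}$ is right-continuous and piecewise constant with infinitely many discontinuities $0<d_1<d_2<\cdots$, $d_k\to\infty$; set $d_0=0$. For a signal with $\sigma(0)=1$ put $t_k=d_{2k-1}-d_{2k-2}$ (times spent in $A_1$) and $s_k=d_{2k}-d_{2k-1}$ (times spent in $A_2$), $k\ge1$. For $\tau,\eta>0$, $\mathcal S[\tau,\eta]$ is the set of signals with $\sigma(0)=1$, $t_k\ge\tau$ and $s_k\le\eta$ for all $k\in\mathbb N$; $\mathcal S'[\tau,\eta]$ is the set of $\sigma\in\mathcal S[\tau,\eta]$ for which the sequence $(t_k,s_k)_{k\ge1}$ does not converge to $(\tau,\eta)$. For a given signal $\sigma$, the system is stable if for every $\varepsilon'>0$ there is $\delta>0$ such that $\|x(0)\|<\delta$ implies $\|x(t)\|<\varepsilon'$ for all $t>0$; it is asymptotically stable if it is stable and $\|x(t)\|\to0$ as $t\to\infty$ for every $x(0)\in\mathbb R^2$. Norms are Euclidean. *)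

(* Defs.v *)
From mathcomp Require Import all_boot all_order all_algebra.
From mathcomp Require Import all_classical all_reals all_analysis.

Set Implicit Arguments.
Unset Strict Implicit.
Unset Printing Implicit Defensive.

Import Order.TTheory GRing.Theory Num.Theory.
Import numFieldNormedType.Exports.

Local Open Scope classical_set_scope.
Local Open Scope ring_scope.

Definition sinh {R : realType} (x : R) : R := (expR x - expR (- x)) / 2.

Definition cosh {R : realType} (x : R) : R := (expR x + expR (- x)) / 2.

Definition arsinh {R : realType} (x : R) : R := ln (x + Num.sqrt (x ^+ 2 + 1)).

Lemma arsinhK (R : realType) : cancel (@arsinh R) (@sinh R).
Proof.
move=> x; rewrite /sinh /arsinh; set s := Num.sqrt _.
have s2 : s ^+ 2 = x ^+ 2 + 1 by rewrite sqr_sqrtr // addr_ge0 // sqr_ge0.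
have sx : `|x| < s.
  by rewrite -(sqrtr_sqr x) ltr_sqrt ?ltrDl // ltr_wpDl // sqr_ge0.
have y0 : 0 < x + s.
  by rewrite -ltrBlDl sub0r (le_lt_trans (ler_norm _)) // normrN.
rewrite expRN lnK ?posrE //.
have -> : (x + s)^-1 = s - x.
  apply: (mulfI (lt0r_neq0 y0)); rewrite divff ?lt0r_neq0 //.
  by rewrite (addrC x) mulrC -subr_sqr s2 addrAC subrr add0r.
by rewrite opprB addrACA subrr addr0 -mulr2n -[_ *+ 2]mulr_natr mulfK // pnatr_eq0.
Qed.

Definition mx2 {R : realType} (a b c d : R) : 'M[R]_2 :=
  \matrix_(i, j) if i == ord0 then (if j == ord0 then a else b)
                 else (if j == ord0 then c else d).

(* The library norm on ['cV[R]_2] is the sup norm. *)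
Definition enorm {R : realType} (x : 'cV[R]_2) : R :=
  Num.sqrt (\sum_i x i ord0 ^+ 2).

Inductive mode := mode1 | mode2.

(* [sw] is the sequence of switching times of [sigma], with the convention
   [sw 0 = 0].  The values of [sigma] at negative times are irrelevant. *)
Definition switching_times {R : realType} (sigma : R -> mode) (sw : nat -> R)
    : Prop :=
  [/\ sw 0%N = 0,
      forall k, sw k < sw k.+1,
      sw @ \oo --> +oo,
      forall k t, sw k <= t < sw k.+1 -> sigma t = sigma (sw k)
    & forall k, sigma (sw k.+1) <> sigma (sw k)].

(* Time spent in [mode1], resp. [mode2], in the [k]-th cycle (counted from 0)
   of a signal starting in [mode1]. *)
Definition dwell1 {R : realType} (sw : nat -> R) (k : nat) : R :=
  sw k.*2.+1 - sw k.*2.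

Definition dwell2 {R : realType} (sw : nat -> R) (k : nat) : R :=
  sw k.*2.+2 - sw k.*2.+1.

Definition signals {R : realType} (tau eta : R) : set (R -> mode) :=
  [set sigma | exists sw : nat -> R,
    [/\ switching_times sigma sw, sigma 0 = mode1 &
        forall k, tau <= dwell1 sw k /\ dwell2 sw k <= eta]].

Definition signals' {R : realType} (tau eta : R) : set (R -> mode) :=
  [set sigma | exists sw : nat -> R,
    [/\ switching_times sigma sw, sigma 0 = mode1,
        forall k, tau <= dwell1 sw k /\ dwell2 sw k <= eta &
        ~ ((dwell1 sw k, dwell2 sw k) @[k --> \oo] --> ((tau, eta) : R * R))]].

Definition active {R : realType} (A1 A2 : 'M[R]_2) (m : mode) : 'M[R]_2 :=
  match m with mode1 => A1 | mode2 => A2 end.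

(* The equation is imposed at the positive times that are not switching times,
   i.e. around which [sigma] is constant. *)
Definition is_solution {R : realType} (A1 A2 : 'M[R]_2) (sigma : R -> mode)
    (x : R -> 'cV[R]_2) : Prop :=
  {within `[0, +oo[, continuous x} /\
  forall t : R, 0 < t -> (\forall s \near t, sigma s = sigma t) ->
    is_derive t 1 x (active A1 A2 (sigma t) *m x t).

Definition stable {R : realType} (A1 A2 : 'M[R]_2) (sigma : R -> mode) : Prop :=
  forall e : R, 0 < e -> exists2 delta : R, 0 < delta &
    forall x, is_solution A1 A2 sigma x -> enorm (x 0) < delta ->
      forall t, 0 < t -> enorm (x t) < e.

Definition asymptotically_stable {R : realType} (A1 A2 : 'M[R]_2)
    (sigma : R -> mode) : Prop :=
  stable A1 A2 sigma /\
  forall x, is_solution A1 A2 sigma x -> enorm (x t) @[t --> +oo] --> (0 : R).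

Definition unique_positive_solution {R : realType} (E : R -> Prop) (t : R)
    : Prop :=
  unique (fun u => 0 < u /\ E u) t.

(* [is_tau21 n1 p2 q2 ac eta eps0 tau]: [tau] is the dwell time
   [tau_{2,1}(eta)]; [ac] stands for the product of the entries in the first
   column of [M], and [eps0] is only used when it vanishes. *)
Definition is_tau21 {R : realType} (n1 p2 q2 ac eta eps0 tau : R) : Prop :=
  let p2t := Num.max 0 p2 in
  let mu := (q2 - p2t) / 2 in
  let nu := (q2 + p2t) / 2 in
  if ac == 0 then tau = q2 / n1 * eta + eps0
  else if p2 == q2 then
    unique_positive_solution
      (fun t => q2 * eta = n1 * t - arsinh (`|ac| * t)) tau
  else if - n1 < ac < 0 then
    exists taup taum : R,
      [/\ unique_positive_solution
            (fun t => ac * t * cosh (mu * eta)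
                      = - sinh (mu * eta) + sinh (n1 * t - nu * eta)) taup,
          unique_positive_solution
            (fun t => - n1 * t * cosh (mu * eta)
                      = - sinh (mu * eta) - sinh (n1 * t - nu * eta)) taum
        & tau = Num.max taup taum]
  else
    unique_positive_solution
      (fun t => ac * t * cosh (mu * eta)
                = - sinh (mu * eta)
                  + Num.sg ac * sinh (n1 * t - nu * eta)) tau.

(* Main.v *)
Require Import Defs.
From mathcomp Require Import all_boot all_order all_algebra.
From mathcomp Require Import all_classical all_reals all_analysis.
From mathcomp Require Import ring lra.

Set Implicit Arguments.
Unset Strict Implicit.
Unset Printing Implicit Defensive.

Import Order.TTheory GRing.Theory Num.Theory.
Import numFieldNormedType.Exports.

Local Open Scope classical_set_scope.
Local Open Scope ring_scope.

(** Put [z = diag(k, 1) P2^-1 x] for some [k > 0].  Over a cycle made of a time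
    [t] in mode 1 and then a time [s] in mode 2, [z] is multiplied by
    [diag(e^(p2 s), e^(q2 s)) B(t)] with [B(t) = e^(- n1 t) (1 + t N)], where
    the nilpotent matrix [N] has rows [- ac, a^2 k] and [- c^2/k, ac].  If for
    one [k] all cycles with [t >= tau] and [s <= eta] have norm at most 1, then
    the norm of [z] does not increase from cycle to cycle; inside a cycle it
    grows by a bounded factor, hence stability.  If moreover the cycles with
    [t >= tau + delta] or [s <= eta - delta] have norm at most some [rho < 1]
    that depends on [delta] only, then [z] tends to 0 for each signal whose
    dwell times do not converge to [(tau, eta)].  These two requirements are
    [contracts], and their consequences [contracts_stable] and
    [contracts_asymptotically_stable].

    If [ac = 0], then [N] has a single nonzero entry, which [k] makes as small
    as desired; the norm of a cycle is then close to [e^(q2 s - n1 t)], and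
    [tau > q2 eta / n1] suffices ([strict_shear_contracts]).

    Let [ac != 0], and write [m = mu eta], [C = nu eta], so that [C + m] is
    [q2 eta] and [C - m] is [max(0, p2) eta].  A cycle is bounded by the one
    with [s = eta] and [p2] replaced by [max(0, p2)].  A suitable [k] makes this
    extreme cycle [e^(C - n1 t)] times a matrix of determinant 1 with opposite
    off-diagonal entries and with diagonal entries that differ by
    [2 u(t) = 2 (sinh m + ac t cosh m)].  The norm of such a matrix is at most
    [e^th] as soon as [|u(t)| <= sinh th] ([skew_sqnorm_le]).  So everything
    comes down to [|u(t)| <= sinh(n1 t - C)] for [t >= tau], with a uniform
    margin away from [tau] ([dwell_margin]), and the equations that define
    [tau] are the cases of equality in this inequality and in a stronger one.
    Existence, uniqueness and margin of their roots follow from the convexity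
    of [w sinh y - y] for [y >= 0] ([dwell_equation_gap]).

    A short mode 2 needs one more argument, since it does not shrink the first
    coordinate by a definite factor when [p2 <= 0].  It shrinks the second one, and the first row of
    the extreme cycle has norm less than 1 at [tau] ([skew_row_lt]), hence also
    near [tau]; away from [tau] the margin is enough ([margin_contracts]). *)

(** * Hyperbolic functions *)

Lemma is_derive_sinh (R : realType) (x : R) : is_derive x 1 sinh (cosh x).
Proof.
have -> : sinh = (2^-1 : R) *: (expR - (expR \o -%R)).
  by apply/funext => y; rewrite /sinh mulrC.
have -> : cosh x = (2^-1 : R) *: (expR x - expR (- x) * -1).
  by rewrite /cosh mulrN1 opprK mulrC.
by apply: is_deriveZ; apply: is_deriveB; apply: is_derive1_comp.
Qed.

Lemma sqr_cosh (R : realType) (x : R) : cosh x ^+ 2 = 1 + sinh x ^+ 2.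
Proof. by rewrite /cosh /sinh expRN; field; rewrite expR_eq0. Qed.

Lemma cosh_gt0 (R : realType) (x : R) : 0 < cosh x.
Proof. by rewrite /cosh divr_gt0 ?addr_gt0 ?expR_gt0. Qed.

Lemma sinhN (R : realType) (x : R) : sinh (- x) = - sinh x.
Proof. by rewrite /sinh opprK; field. Qed.

Lemma sinh0 (R : realType) : sinh (0 : R) = 0.
Proof. by rewrite /sinh oppr0 subrr mul0r. Qed.

Lemma ltr_sinh (R : realType) : {mono (@sinh R) : x y / x < y}.
Proof.
apply: leW_mono; apply: le_mono => x y xy.
have := xy; rewrite -ltr_expR => e1.
have := xy; rewrite -ltrN2 -ltr_expR => e2.
by rewrite /sinh ltr_pM2r ?invr_gt0 //; lra.
Qed.

Lemma ler_sinh (R : realType) : {mono (@sinh R) : x y / x <= y}.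
Proof. by move=> x y; rewrite !leNgt ltr_sinh. Qed.

Lemma sinh_inj (R : realType) : injective (@sinh R).
Proof.
move=> x y e; case: (ltgtP x y) => //; rewrite -ltr_sinh e ltxx //.
 Qed.

Lemma sinhK (R : realType) : cancel (@sinh R) arsinh.
Proof. by move=> x; apply: sinh_inj; rewrite arsinhK. Qed.

Lemma sinh_ge0 (R : realType) (x : R) : (0 <= sinh x) = (0 <= x).
Proof. by rewrite -{1}(sinh0 R) ler_sinh. Qed.

Lemma sinh_gt0 (R : realType) (x : R) : (0 < sinh x) = (0 < x).
Proof. by rewrite -{1}(sinh0 R) ltr_sinh. Qed.

Lemma ltr_cosh (R : realType) (x m : R) : `|x| < m -> cosh x < cosh m.
Proof.
rewrite ltr_norml => /andP[mx xm].
rewrite -(ltr_pXn2r (n := 2)) // ?nnegrE ?ltW ?cosh_gt0 // !sqr_cosh ltrD2l.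
have s1 : - sinh m < sinh x by rewrite -sinhN ltr_sinh.
have s2 : sinh x < sinh m by rewrite ltr_sinh.
nra.
Qed.

(** Everything needed about the shape of [w * sinh y - y] comes from this and
    from the monotonicity of [cosh]; its convexity is never stated as such. *)
Lemma sinh_sub_id_MVT (R : realType) (w x y : R) : x < y ->
  exists2 c, x < c < y &
    (w * sinh y - y) - (w * sinh x - x) = (w * cosh c - 1) * (y - x).
Proof.
move=> xy.
have dH (z : R) : is_derive z 1 (fun z => w * sinh z - z) (w * cosh z - 1).
  exact: (is_deriveB (is_deriveZ w (is_derive_sinh z)) (is_derive_id z 1)).
have [|c cxy e] := MVT xy (fun z _ => dH z).
  apply: continuous_subspaceT => z.
  by apply/differentiable_continuous/derivable1_diffP; case: (dH z).
by exists c => //; move: cxy; rewrite in_itv.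
Qed.

Lemma continuous_sinh (R : realType) : continuous (@sinh R).
Proof.
move=> z; apply/differentiable_continuous/derivable1_diffP.
by case: (is_derive_sinh z).
Qed.

(** * Roots and margins of the dwell-time equations *)

(** By convexity on [m, +oo[: a level that exceeds the value at [m] is reached
    with a positive slope, and the slope only grows afterwards. *)
Lemma sinh_sub_id_incr (R : realType) (w C m y1 y2 : R) : 0 < w -> 0 <= m ->
  m < y1 -> w * sinh m - m < C -> C <= w * sinh y1 - y1 -> y1 < y2 ->
  w * sinh y1 - y1 < w * sinh y2 - y2.
Proof.
move=> w0 m0 my1 Hm H1 y12.
have [c1 /andP[mc1 c1y] e1] := sinh_sub_id_MVT w my1.
have [c2 /andP[yc2 _] e2] := sinh_sub_id_MVT w y12.
have c12 : cosh c1 < cosh c2 by apply: ltr_cosh; rewrite ger0_norm; lra.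
have p1 : 0 < w * cosh c1 - 1.
  have : 0 < (w * cosh c1 - 1) * (y1 - m) by lra.
  by rewrite pmulr_lgt0; lra.
have p2 : 0 < w * cosh c2 - 1 by nra.
by rewrite -subr_gt0 e2 mulr_gt0 //; lra.
Qed.

(** A superlinear lower bound: it gives an upper end point to the intermediate
    value theorem when [w * sinh y - y] is to reach a given level. *)
Lemma sinh_sqr_ge (R : realType) (y : R) : 0 <= y -> y ^+ 2 / 8 <= sinh y.
Proof.
move=> y0.
have e1 := expR_ge1Dx (y / 2).
have e2 : expR y = expR (y / 2) ^+ 2.
  by rewrite expr2 -expRD; congr expR; field.
have e3 : expR (- y) <= 1 by rewrite -expR0 ler_expR; lra.
by rewrite /sinh e2 ler_pdivlMr //; nra.
Qed.

(** The equation [sinh (n * t - C) = A * t + B] to the right of a point [t0]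
    where the left-hand side is the smaller one.  With
    [y = arsinh (A * t + B)], the difference [n * t - C - y] becomes
    [n / A * sinh y - y] minus a constant, and [t >= t0] becomes [y >= m],
    a region where this function of [y] is convex because [m >= 0]. *)
Section dwell_equation.
Context (R : realType) (n A B C m t0 : R).
Context (n0 : 0 < n) (A0 : 0 < A) (m0 : 0 <= m).
Context (At0 : A * t0 + B = sinh m) (nt0 : n * t0 - C < m).

Let H y := n / A * sinh y - y.
Let K := C + n / A * B.

Let gapE t : n * t - C - arsinh (A * t + B) = H (arsinh (A * t + B)) - K.
Proof. by rewrite /H /K arsinhK; field; rewrite gt_eqF. Qed.

Let Hm : H m < K.
Proof.
by have := gapE t0; rewrite At0 sinhK -subr_lt0 => <-; rewrite subr_lt0.
Qed.

Let arsinh_gt t : t0 < t -> m < arsinh (A * t + B).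
Proof. by move=> tt; rewrite -ltr_sinh arsinhK -At0 ltrD2r ltr_pM2l. Qed.

(** Past its root the equation turns into a strict inequality, whose margin is
    uniform on each half-line starting to the right of the root. *)
Lemma dwell_equation_gap tau delta : t0 < tau ->
  sinh (n * tau - C) = A * tau + B -> 0 < delta ->
  exists2 kappa, 0 < kappa &
    forall t, tau + delta <= t -> A * t + B <= sinh (n * t - C - kappa).
Proof.
move=> tt root d0.
(* The difference increases, so its value at the left end of the half-line
   is a valid margin. *)
have nA : 0 < n / A by rewrite divr_gt0.
pose y t := arsinh (A * t + B).
have ymono t t' : t <= t' -> y t <= y t'.
  by move=> tt'; rewrite -ler_sinh !arsinhK lerD2r ler_pM2l.
have Hroot : H (y tau) = K.
  apply/eqP; rewrite -subr_eq0 -gapE -root sinhK subrr //.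
have Hlt u v : tau <= u -> K <= H (y u) -> u < v -> H (y u) < H (y v).
  move=> tu Ku uv; apply: (@sinh_sub_id_incr _ _ K m) => //.
    by apply: arsinh_gt; apply: lt_le_trans tu.
  by rewrite -ltr_sinh !arsinhK ltrD2r ltr_pM2l.
have gap : 0 < H (y (tau + delta)) - K.
  by rewrite subr_gt0 -{1}Hroot; apply: Hlt; rewrite ?Hroot //; lra.
exists (H (y (tau + delta)) - K) => // t tt'.
rewrite -[leLHS]arsinhK ler_sinh -/(y t).
have le : H (y (tau + delta)) <= H (y t).
  case: (ltgtP (tau + delta) t) tt' => // [lt _|<- _ //].
  by apply/ltW/Hlt; lra.
by have := gapE t; rewrite -/(y t); lra.
Qed.

(** If there were two roots, the margin of the smaller one would be positive at
    the larger one. *)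
Lemma dwell_equation_unique tau tau' : t0 < tau -> t0 < tau' ->
  sinh (n * tau - C) = A * tau + B -> sinh (n * tau' - C) = A * tau' + B ->
  tau = tau'.
Proof.
have no_lt u v : t0 < u -> sinh (n * u - C) = A * u + B ->
    sinh (n * v - C) = A * v + B -> ~ u < v.
  move=> tu ru rv uv.
  have vu : 0 < v - u by lra.
  have [k k0 /(_ v)] := dwell_equation_gap tu ru vu.
  by rewrite -rv ler_sinh; lra.
move=> t1 t2 r1 r2; case: (ltgtP tau tau') => // [/no_lt|/no_lt]; by case.
Qed.

Lemma dwell_equation_ex :
  exists2 tau, t0 < tau & sinh (n * tau - C) = A * tau + B.
Proof.
have nA : 0 < n / A by rewrite divr_gt0.
have [y y1 ky] : exists2 y : R, 1 + m <= y & 8 * (1 + `|K|) <= n / A * y.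
  have q0 : 0 <= 8 * (1 + `|K|) / (n / A) by rewrite divr_ge0 ?(ltW nA).
  exists (8 * (1 + `|K|) / (n / A) + (1 + m)); first by rewrite lerDr.
  rewrite [leRHS]mulrDr [X in _ <= X + _]mulrC divfK ?gt_eqF // lerDl.
  by rewrite mulr_ge0 ?(ltW nA) ?addr_ge0.
have HyK : K <= H y.
  have y0 : 0 <= y by rewrite (le_trans _ y1) ?addr_ge0.
  have s : n / A * (y ^+ 2 / 8) <= n / A * sinh y.
    by rewrite ler_pM2l ?sinh_sqr_ge.
  apply: le_trans (ler_norm K) _; rewrite /H.
  have := normr_ge0 K; move: `|K| (n / A) nA s ky => k w w0 s ky k0.
  have yge1 : 1 <= y by rewrite (le_trans _ y1) // lerDl.
  have e1 : (1 + k) * y <= w * (y ^+ 2 / 8) by nra.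
  nra.
have cont : {within `[m, y], continuous H}.
  apply: continuous_subspaceT => z; apply: cvgB; last exact: cvg_id.
  by apply: cvgMr; exact: continuous_sinh.
have my : m <= y by lra.
have [|c cmy Hc] := IVT (v := K) my cont.
  by rewrite ge_min le_max HyK (ltW Hm) orbT.
have cm : m < c.
  rewrite lt_neqAle; apply/andP; split; last by rewrite (itvP cmy).
  by apply/eqP => e; move: Hm; rewrite e Hc ltxx.
have ct : A * ((sinh c - B) / A) + B = sinh c by field; rewrite gt_eqF.
exists ((sinh c - B) / A).
  by rewrite -(ltr_pM2l A0) -(ltrD2r B) ct At0 ltr_sinh.
have := gapE ((sinh c - B) / A); rewrite ct sinhK Hc subrr => /eqP.
by rewrite subr_eq0 => /eqP ->.
Qed.

End dwell_equation.

(** When [B = - sinh m], the values [- m < y <= m] come before the half-line on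
    which the lemmas above apply, and this excludes a root there.  By the mean
    value theorem, [k * cosh m * t = sinh y + sinh m < (y + m) * cosh m], hence
    [k * t < y + m]; then [n <= k] and [m <= C] give [n * t - C < y].  The upper
    bound on [t] says that [y <= m]. *)
Lemma dwell_equation_below (R : realType) (n k C m t : R) :
  0 < n <= k -> 0 < m -> m <= C -> 0 < t -> k * t * cosh m <= 2 * sinh m ->
  sinh (n * t - C) < k * cosh m * t - sinh m.
Proof.
move=> /andP[n0 nk] m0 mC t0 tle.
rewrite -[ltRHS]arsinhK ltr_sinh; set y := arsinh _.
have Sy : sinh y = k * cosh m * t - sinh m by rewrite arsinhK.
have c0 := cosh_gt0 m.
have k0 : 0 < k by lra.
have ym : - m < y.
  by rewrite -ltr_sinh Sy sinhN; have := mulr_gt0 (mulr_gt0 k0 c0) t0; lra.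
have ym' : y <= m by rewrite -ler_sinh Sy; lra.
have [c /andP[mc cy]] := sinh_sub_id_MVT 1 ym.
have cm : cosh c < cosh m by apply: ltr_cosh; rewrite ltr_norml; lra.
rewrite sinhN Sy => e.
have : cosh m * (k * t) < cosh m * (y + m) by nra.
rewrite ltr_pM2l //; nra.
Qed.

(** What the stability proof needs to know about the dwell time [tau].  In an
    extreme cycle (mode 2 as long as allowed), [u t] is half the difference of
    the diagonal entries once the determinant is scaled to 1, and
    [expR (- (n * t - C))] is the factor removed by this scaling. *)
Definition dwell_margin (R : realType) (u : R -> R) (n C tau : R) : Prop :=
  [/\ 0 < tau, 0 < n * tau - C, `|u tau| <= sinh (n * tau - C) &
      forall delta, 0 < delta -> exists2 kappa, 0 < kappa &
        forall t, tau + delta <= t -> `|u t| <= sinh (n * t - C - kappa)].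

(** The case [`|u t| = A * t + sinh m], which covers a positive slope of [u],
    and equal rates ([m = 0]) with a slope of either sign.  Here [y >= m] holds
    for all [t >= 0]. *)
Lemma dwell_incr_ex (R : realType) (n A C m : R) :
  0 < n -> 0 < A -> 0 <= m -> 0 < C ->
  exists tau, unique_positive_solution
    (fun t => sinh (n * t - C) = A * t + sinh m) tau.
Proof.
move=> n0 A0 m0 C0.
have At0 : A * 0 + sinh m = sinh m by lra.
have nt0 : n * 0 - C < m by lra.
have [tau t0 root] := dwell_equation_ex n0 A0 m0 At0 nt0.
exists tau; split=> // t [t1 r1].
exact: (dwell_equation_unique n0 A0 m0 At0 nt0).
Qed.

Lemma dwell_incr_margin (R : realType) (n A C m tau : R) (u : R -> R) :
  0 < n -> 0 < A -> 0 <= m -> 0 < C -> 0 < tau ->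
  (forall t, 0 < t -> `|u t| = A * t + sinh m) ->
  sinh (n * tau - C) = A * tau + sinh m -> dwell_margin u n C tau.
Proof.
move=> n0 A0 m0 C0 t0 uE root.
have At0 : A * 0 + sinh m = sinh m by lra.
have nt0 : n * 0 - C < m by lra.
split=> //.
- have s0 : 0 <= sinh m by rewrite sinh_ge0.
  by rewrite -sinh_gt0 root; have := mulr_gt0 A0 t0; lra.
- by rewrite uE // root.
move=> delta d0.
have [kappa k0 gap] := dwell_equation_gap n0 A0 m0 At0 nt0 t0 root d0.
by exists kappa => // t tt; rewrite uE ?gap //; lra.
Qed.

(** The case [u = sinh m - k * cosh m * t] with [k >= n].  The half-line
    [y >= m] starts at the time [t0] where [u = - sinh m], and the root lies
    beyond it, so that [u] is negative from the root on. *)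
Section dwell_decr.
Context (R : realType) (n k C m : R).
Context (n0 : 0 < n) (nk : n <= k) (m0 : 0 < m) (mC : m <= C).

Let A := k * cosh m.
Let t0 := 2 * sinh m / A.

Let A0 : 0 < A.
Proof. by rewrite mulr_gt0 ?cosh_gt0 ?(lt_le_trans n0). Qed.

Let m0' : 0 <= m. Proof. exact: ltW. Qed.

Let At0 : A * t0 + - sinh m = sinh m.
Proof. by rewrite /t0 mulrC divfK ?gt_eqF //; ring. Qed.

Let t0_gt0 : 0 < t0.
Proof. by apply: divr_gt0 A0; rewrite mulr_gt0 ?sinh_gt0. Qed.

Let below t : 0 < t -> t <= t0 -> sinh (n * t - C) < A * t + - sinh m.
Proof.
move=> t1 t2; apply: dwell_equation_below => //; first by rewrite n0.
by rewrite mulrAC -/A mulrC -ler_pdivlMr.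
Qed.

Let nt0 : n * t0 - C < m.
Proof. by rewrite -ltr_sinh -At0 below. Qed.

Let root_gt t : 0 < t -> sinh (n * t - C) = A * t + - sinh m -> t0 < t.
Proof.
by move=> t1 root; rewrite ltNge; apply/negP => /(below t1); rewrite root ltxx.
Qed.

Lemma dwell_decr_ex : exists tau, unique_positive_solution
  (fun t => sinh (n * t - C) = k * cosh m * t - sinh m) tau.
Proof.
have [tau tt root] := dwell_equation_ex n0 A0 m0' At0 nt0.
exists tau; split; first by split=> //; apply: lt_trans tt.
move=> t [t1 r1].
by apply: (dwell_equation_unique n0 A0 m0' At0 nt0) => //; apply: root_gt.
Qed.

Lemma dwell_decr_gt tau : 0 < tau ->
  sinh (n * tau - C) = k * cosh m * tau - sinh m ->
  sinh m < k * cosh m * tau - sinh m.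
Proof. by move=> t1 root; rewrite -[ltLHS]At0 ltrD2r ltr_pM2l ?root_gt. Qed.

Lemma dwell_decr_gap tau delta : 0 < tau ->
  sinh (n * tau - C) = k * cosh m * tau - sinh m -> 0 < delta ->
  exists2 kappa, 0 < kappa &
    forall t, tau + delta <= t ->
      k * cosh m * t - sinh m <= sinh (n * t - C - kappa).
Proof.
move=> t1 root; apply: (dwell_equation_gap n0 A0 m0' At0 nt0) => //.
exact: root_gt.
Qed.

Lemma dwell_decr_margin tau : 0 < tau ->
  sinh (n * tau - C) = k * cosh m * tau - sinh m ->
  dwell_margin (fun t => sinh m - k * cosh m * t) n C tau.
Proof.
move=> t1 root; have s0 : 0 < sinh m by rewrite sinh_gt0.
have gt := dwell_decr_gt t1 root.
have uE t : tau <= t ->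
    `|sinh m - k * cosh m * t| = k * cosh m * t - sinh m.
  move=> tt; have : k * cosh m * tau <= k * cosh m * t by rewrite ler_pM2l.
  by move=> le; rewrite ler0_norm; lra.
split=> //.
- by rewrite -sinh_gt0 root; lra.
- by rewrite uE // root.
move=> delta d0; have [kappa k0 gap] := dwell_decr_gap t1 root d0.
by exists kappa => // t tt; rewrite uE ?gap //; lra.
Qed.

End dwell_decr.

(** The two sides of this equation are monotone in opposite directions. *)
Lemma dwell_mixed_ex (R : realType) (n A C m : R) :
  0 < n -> 0 < A -> 0 < C -> 0 <= m ->
  exists tau, unique_positive_solution
    (fun t => sinh (n * t - C) = sinh m - A * t) tau.
Proof.
move=> n0 A0 C0 m0.
pose f := fun t : R => sinh (n * t - C) + A * t.
have fmono (t t' : R) : t < t' -> f t < f t'.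
  move=> tt; apply: ltrD; last by rewrite ltr_pM2l.
  by rewrite ltr_sinh ltrD2r ltr_pM2l.
pose T := C / n + sinh m / A.
have s0 : 0 <= sinh m by rewrite sinh_ge0.
have T0 : 0 < T by rewrite ltr_pwDl ?divr_gt0 // divr_ge0 // ltW.
have f0 : f 0 < sinh m.
  by rewrite /f !mulr0 addr0 sub0r ltr_sinh; lra.
have fT : sinh m <= f T.
  rewrite /f /T !mulrDr; apply: (@le_trans _ _ (A * (sinh m / A))).
    by rewrite mulrC divfK ?gt_eqF.
  have nA : 0 <= n * (sinh m / A) by rewrite pmulr_rge0 // divr_ge0 // ltW.
  have AC : 0 <= A * (C / n) by rewrite pmulr_rge0 // divr_ge0 // ltW.
  have nC : n * (C / n) = C by rewrite mulrC divfK ?gt_eqF.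
  have := sinh_ge0 (n * (C / n) + n * (sinh m / A) - C).
  by rewrite nC (_ : 0 <= _ + _ - C) => [/idP|]; lra.
have cont : {within `[0, T], continuous f}.
  apply: continuous_subspaceT => z; apply: cvgD; last first.
    by apply: cvgMr; exact: cvg_id.
  apply: (@continuous_comp R R R (fun t => n * t - C) sinh);
    last exact: continuous_sinh.
  by apply: cvgB; [apply: cvgMr; exact: cvg_id|exact: cvg_cst].
have [|tau tin ft] := IVT (v := sinh m) (ltW T0) cont.
  by rewrite ge_min le_max fT (ltW f0) orbT.
have t0 : 0 < tau.
  rewrite lt_neqAle (itvP tin) andbT; apply/eqP => e.
  by move: f0; rewrite e ft ltxx.
exists tau; split; first by split=> //; move: ft; rewrite /f; lra.
move=> t [_ root]; have ft' : f t = f tau by rewrite ft /f root; lra.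
by case: (ltgtP tau t) => // /fmono; rewrite ft' ltxx.
Qed.

(** For [0 < k < n] both bounds [u <= sinh (n * t - C)] and
    [- u <= sinh (n * t - C)] are at stake.  The first one holds from its own
    root [tp] on, because [u] decreases.  The second one need not
    persist past its own first root, but it follows from the corresponding bound with
    [k] replaced by [n], which holds from [tm] on; this replacement is strict,
    hence [sinh (n * tau - C) > 0] even where [u] vanishes. *)
Lemma dwell_mixed_margin (R : realType) (n k C m tp tm : R) :
  0 < n -> 0 < k < n -> 0 < m -> m <= C -> 0 < tp -> 0 < tm ->
  sinh (n * tp - C) = sinh m - k * cosh m * tp ->
  sinh (n * tm - C) = n * cosh m * tm - sinh m ->
  dwell_margin (fun t => sinh m - k * cosh m * t) n C (Num.max tp tm).
Proof.
move=> n0 /andP[k0 kn] m0 mC tp0 tm0 rp rm.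
set tau := Num.max tp tm.
have tpt : tp <= tau by rewrite le_max lexx.
have tmt : tm <= tau by rewrite le_max lexx orbT.
have t0 : 0 < tau by lra.
have c0 := cosh_gt0 m.
have kc0 : 0 < k * cosh m := mulr_gt0 k0 c0.
have lower (t : R) : 0 < t -> k * cosh m * t - sinh m < n * cosh m * t - sinh m.
  by move=> t1; rewrite ltrD2r ltr_pM2r // ltr_pM2r.
have upper (t t' : R) :
    t <= t' -> sinh m - k * cosh m * t' <= sinh m - k * cosh m * t.
  by move=> tt; rewrite lerD2l lerN2 ler_pM2l.
have lowtau : n * cosh m * tau - sinh m <= sinh (n * tau - C).
  have [e|] := eqVneq tm tau; first by rewrite -e rm.
  move=> ne; have d0 : 0 < tau - tm by rewrite subr_gt0 lt_neqAle ne.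
  have [ka ka0 /(_ tau)] := dwell_decr_gap n0 (lexx n) m0 mC tm0 rm d0.
  rewrite addrC subrK => /(_ (lexx _)) h; apply: le_trans h _.
  by rewrite ler_sinh; lra.
have uptau : sinh m - k * cosh m * tau <= sinh (n * tau - C).
  apply: le_trans (upper _ _ tpt) _; rewrite -rp ler_sinh; nra.
have low1 := lower tau t0.
split=> //.
- by rewrite -sinh_gt0; lra.
- by rewrite ler_norml; lra.
move=> delta d0.
have [ka ka0 gap] := dwell_decr_gap n0 (lexx n) m0 mC tm0 rm d0.
exists (Num.min ka (n * delta)); first by rewrite lt_min ka0 mulr_gt0.
move=> t tt; have tt' : 0 < t by lra.
have h1 : n * cosh m * t - sinh m <= sinh (n * t - C - Num.min ka (n * delta)).
  have tm1 : tm + delta <= t by lra.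
  apply: le_trans (gap _ tm1) _.
  by rewrite ler_sinh lerD2l lerN2 ge_min lexx.
have h2 : sinh m - k * cosh m * t <= sinh (n * t - C - Num.min ka (n * delta)).
  have tp1 : tp <= t by lra.
  apply: le_trans (upper _ _ tp1) _; rewrite -rp ler_sinh.
  have : Num.min ka (n * delta) <= n * delta by rewrite ge_min lexx orbT.
  nra.
by have := lower _ tt'; rewrite ler_norml; lra.
Qed.

(** * The dwell time of the theorem *)

Lemma eq_unique_positive_solution (R : realType) (E E' : R -> Prop) (t : R) :
  (forall u, E u <-> E' u) ->
  unique_positive_solution E t <-> unique_positive_solution E' t.
Proof.
move=> EE; split=> -[[t0 Et] uniq].
  by split=> [|u [u0 /EE Eu]]; [split=> //; apply/EE|apply: uniq].
by split=> [|u [u0 /EE Eu]]; [split=> //; apply/EE|apply: uniq].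
Qed.

Lemma eq_dwell_margin (R : realType) (u v : R -> R) (n C tau : R) :
  u =1 v -> dwell_margin u n C tau -> dwell_margin v n C tau.
Proof. by move=> /funext ->. Qed.

Section tau21.
Context (R : realType) (n1 p2 q2 ac eta eps0 : R).
Context (n1_gt0 : 0 < n1) (p2q2 : 0 < p2 <= q2 \/ p2 <= 0 < q2).
Context (ac_neq0 : ac != 0) (eta_gt0 : 0 < eta).

Context (p2t : R) (p2tE : p2t = Num.max 0 p2).
Let mu := (q2 - p2t) / 2.
Let nu := (q2 + p2t) / 2.

Let p2t_ge0 : 0 <= p2t. Proof. by rewrite p2tE le_max lexx. Qed.

Let q2_gt0 : 0 < q2. Proof. case: p2q2; lra. Qed.

Let p2t_le : p2t <= q2.
Proof. by rewrite p2tE ge_max (ltW q2_gt0) /=; case: p2q2; lra. Qed.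

Let nu_gt0 : 0 < nu * eta.
Proof. by apply: mulr_gt0 => //; rewrite divr_gt0 // ltr_pwDl. Qed.

Let mu_ge0 : 0 <= mu * eta.
Proof. by rewrite mulr_ge0 ?(ltW eta_gt0) // divr_ge0 // subr_ge0. Qed.

Let mu_le_nu : mu * eta <= nu * eta.
Proof. by rewrite ler_pM2r // /mu /nu; have := p2t_ge0; lra. Qed.

Let mu_gt0 : p2 != q2 -> 0 < mu * eta.
Proof.
move=> pq; apply: mulr_gt0 => //; have : p2t < q2.
  rewrite p2tE gt_max q2_gt0 /= lt_neqAle pq /=.
  by have := p2t_le; rewrite p2tE ge_max => /andP[].
by rewrite /mu; lra.
Qed.

Let equal_rates : p2 = q2 -> mu * eta = 0 /\ nu * eta = q2 * eta.
Proof.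
move=> pq; have -> : nu = q2 by rewrite /nu p2tE pq max_r ?(ltW q2_gt0) //; lra.
by rewrite /mu p2tE pq max_r ?(ltW q2_gt0) // subrr !mul0r.
Qed.

Let equal_eq t : q2 * eta = n1 * t - arsinh (`|ac| * t) <->
  sinh (n1 * t - q2 * eta) = `|ac| * t + sinh 0.
Proof.
rewrite sinh0 addr0; split=> [|<-]; last by rewrite sinhK; lra.
by move=> e; rewrite -[RHS]arsinhK; congr sinh; lra.
Qed.

Let pos_eq t : 0 < ac ->
  ac * t * cosh (mu * eta)
    = - sinh (mu * eta) + Num.sg ac * sinh (n1 * t - nu * eta) <->
  sinh (n1 * t - nu * eta) = ac * cosh (mu * eta) * t + sinh (mu * eta).
Proof. by move=> ac0; rewrite gtr0_sg // mul1r; split; lra. Qed.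

Let neg_eq t : ac < 0 ->
  ac * t * cosh (mu * eta)
    = - sinh (mu * eta) + Num.sg ac * sinh (n1 * t - nu * eta) <->
  sinh (n1 * t - nu * eta) = - ac * cosh (mu * eta) * t - sinh (mu * eta).
Proof. by move=> ac0; rewrite ltr0_sg // mulN1r; split; lra. Qed.

Let plus_eq t : ac * t * cosh (mu * eta)
    = - sinh (mu * eta) + sinh (n1 * t - nu * eta) <->
  sinh (n1 * t - nu * eta) = sinh (mu * eta) - (- ac * cosh (mu * eta)) * t.
Proof. by split; lra. Qed.

Let minus_eq t : - n1 * t * cosh (mu * eta)
    = - sinh (mu * eta) - sinh (n1 * t - nu * eta) <->
  sinh (n1 * t - nu * eta) = n1 * cosh (mu * eta) * t - sinh (mu * eta).
Proof. by split; lra. Qed.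

Lemma tau21_ex : exists tau, is_tau21 n1 p2 q2 ac eta eps0 tau.
Proof.
rewrite /is_tau21 (negPf ac_neq0) -p2tE -/mu -/nu.
have c0 := cosh_gt0 (mu * eta).
case: eqVneq => [pq|pq].
  have a0 : 0 < `|ac| by rewrite normr_gt0.
  have [|tau Htau] := dwell_incr_ex n1_gt0 a0 (lexx 0) (_ : 0 < q2 * eta).
    by rewrite mulr_gt0.
  by exists tau; apply/(eq_unique_positive_solution _ equal_eq).
have m0 := mu_gt0 pq.
case: (boolP (- n1 < ac < 0)) => [/andP[acn ac0]|acn].
  have ac0' : 0 < - ac * cosh (mu * eta) by rewrite mulr_gt0 // oppr_gt0.
  have [tp Htp] := dwell_mixed_ex n1_gt0 ac0' nu_gt0 mu_ge0.
  have [tm Htm] := dwell_decr_ex n1_gt0 (lexx n1) m0 mu_le_nu.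
  exists (Num.max tp tm), tp, tm; split=> //.
    exact/(eq_unique_positive_solution _ plus_eq).
  exact/(eq_unique_positive_solution _ minus_eq).
have /orP[ac0|ac0] : (ac < 0) || (0 < ac) by rewrite -neq_lt.
  have acn' : n1 <= - ac by move: acn; rewrite ac0 andbT; lra.
  have [tau Htau] := dwell_decr_ex n1_gt0 acn' m0 mu_le_nu.
  by exists tau; apply/(eq_unique_positive_solution _ (neg_eq ^~ ac0)).
have [tau Htau] := dwell_incr_ex n1_gt0 (mulr_gt0 ac0 c0) mu_ge0 nu_gt0.
by exists tau; apply/(eq_unique_positive_solution _ (pos_eq ^~ ac0)).
Qed.

(** For equal rates [mu = 0], hence [`|u t| = `|ac| * t] whatever the sign of
    [ac]; otherwise the three ranges of [ac] are the three cases treated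
    above. *)
Lemma tau21_margin tau : is_tau21 n1 p2 q2 ac eta eps0 tau ->
  dwell_margin (fun t => sinh (mu * eta) + ac * t * cosh (mu * eta))
    n1 (nu * eta) tau.
Proof.
rewrite /is_tau21 (negPf ac_neq0) -p2tE -/mu -/nu.
have c0 := cosh_gt0 (mu * eta).
case: eqVneq => [pq|pq].
  have [muE nuE] := equal_rates pq.
  move=> /(eq_unique_positive_solution _ equal_eq)[[t0 root] _].
  rewrite nuE muE.
  apply: (dwell_incr_margin n1_gt0 _ (lexx 0) _ t0 _ root).
  - by rewrite normr_gt0.
  - by rewrite mulr_gt0.
  move=> t t1; rewrite sinh0 add0r addr0 /cosh oppr0 expR0 divff ?mulr1 //.
  by rewrite normrM (gtr0_norm t1).
have m0 := mu_gt0 pq.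
case: (boolP (- n1 < ac < 0)) => [/andP[acn ac0] [tp [tm []]]|acn].
  move=> /(eq_unique_positive_solution _ plus_eq)[[tp0 rp] _].
  move=> /(eq_unique_positive_solution _ minus_eq)[[tm0 rm] _] ->.
  apply: (@eq_dwell_margin _
    (fun t => sinh (mu * eta) - - ac * cosh (mu * eta) * t)).
    by move=> t; ring.
  by apply: dwell_mixed_margin => //; lra.
have /orP[ac0|ac0] : (ac < 0) || (0 < ac) by rewrite -neq_lt.
  have acn' : n1 <= - ac by move: acn; rewrite ac0 andbT; lra.
  move=> /(eq_unique_positive_solution _ (neg_eq ^~ ac0))[[t0 root] _].
  apply: (@eq_dwell_margin _
    (fun t => sinh (mu * eta) - - ac * cosh (mu * eta) * t)).
    by move=> t; ring.
  exact: dwell_decr_margin.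
move=> /(eq_unique_positive_solution _ (pos_eq ^~ ac0))[[t0 root] _].
apply: (dwell_incr_margin n1_gt0 (mulr_gt0 ac0 c0) mu_ge0 nu_gt0 t0 _ root).
move=> t t1; have s0 : 0 <= sinh (mu * eta) by rewrite sinh_ge0.
have := mulr_gt0 (mulr_gt0 ac0 t1) c0.
by move=> h; rewrite ger0_norm; lra.
Qed.

End tau21.

(** * Euclidean norms of planar vectors *)

Definition sqnorm (R : realType) (z : 'cV[R]_2) : R :=
  z ord0 ord0 ^+ 2 + z ord_max ord0 ^+ 2.

Lemma enormE (R : realType) (z : 'cV[R]_2) : enorm z = Num.sqrt (sqnorm z).
Proof.
rewrite /enorm !big_ord_recl big_ord0 /= addr0.
by congr (Num.sqrt (z _ _ ^+ 2 + z _ _ ^+ 2)); apply/val_inj.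
Qed.

Lemma sqnorm_ge0 (R : realType) (z : 'cV[R]_2) : 0 <= sqnorm z.
Proof. by rewrite addr_ge0 ?sqr_ge0. Qed.

Lemma enorm_lt (R : realType) (z : 'cV[R]_2) (e : R) :
  0 < e -> (enorm z < e) = (sqnorm z < e ^+ 2).
Proof.
move=> e0; rewrite enormE -{1}(gtr0_norm e0) -sqrtr_sqr ltr_sqrt //.
by rewrite exprn_gt0.
Qed.

Lemma mx2_mul_col (R : realType) (a b c d : R) (z : 'cV[R]_2) :
  ((mx2 a b c d *m z) ord0 ord0 = a * z ord0 ord0 + b * z ord_max ord0) *
  ((mx2 a b c d *m z) ord_max ord0 = c * z ord0 ord0 + d * z ord_max ord0).
Proof.
by split; rewrite !mxE !big_ord_recl big_ord0 /= addr0 !mxE /=;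
  congr (_ * z _ _ + _ * z _ _); apply/val_inj.
Qed.

Lemma mx2_mul (R : realType) (a b c d a' b' c' d' : R) :
  mx2 a b c d *m mx2 a' b' c' d' =
  mx2 (a * a' + b * c') (a * b' + b * d') (c * a' + d * c') (c * b' + d * d').
Proof.
apply/matrixP => i j; rewrite !mxE !big_ord_recl big_ord0 /= addr0.
by rewrite !mxE /=; case: ifP; case: ifP.
Qed.

Lemma mx2_eta (R : realType) (Q : 'M[R]_2) :
  Q = mx2 (Q ord0 ord0) (Q ord0 ord_max) (Q ord_max ord0) (Q ord_max ord_max).
Proof.
apply/matrixP => i j; rewrite !mxE; case: i j => [[|[|//]] ?] [[|[|//]] ?] /=;
  congr (Q _ _); exact/val_inj.
Qed.

Lemma sqnorm_mx2_le (R : realType) (a b c d : R) (z : 'cV[R]_2) :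
  sqnorm (mx2 a b c d *m z) <=
  (a ^+ 2 + b ^+ 2 + c ^+ 2 + d ^+ 2) * sqnorm z.
Proof.
rewrite /sqnorm !mx2_mul_col.
move: (z ord0 ord0) (z ord_max ord0) => x y.
have := sqr_ge0 (a * y - b * x); have := sqr_ge0 (c * y - d * x); nra.
Qed.

Lemma sqnorm_mul_le (R : realType) (Q : 'M[R]_2) :
  exists2 K, 0 < K & forall z, sqnorm (Q *m z) <= K * sqnorm z.
Proof.
rewrite (mx2_eta Q); set a := Q _ _; set b := Q _ _.
set c := Q _ _; set d := Q _ _.
exists (a ^+ 2 + b ^+ 2 + c ^+ 2 + d ^+ 2 + 1).
  by rewrite ltr_wpDl // !addr_ge0 ?sqr_ge0.
move=> z; apply: le_trans (sqnorm_mx2_le _ _ _ _ z) _.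
by rewrite ler_wpM2r ?sqnorm_ge0 // lerDl.
Qed.

(** The hypotheses amount to [p^2 <= q^2 + (E - 1/E) p q], that is
    [(p - E q) (p + q/E) <= 0]. *)
Lemma sqr_le_skew (R : realType) (E s p q : R) : 0 < E -> 0 <= p -> 0 <= q ->
  `|s| <= (E - E^-1) / 2 * (p * q) -> p ^+ 2 = q ^+ 2 - 2 * s ->
  p <= E * q.
Proof.
move=> E0 p0 q0 sle pE.
have Ei : E * E^-1 = 1 by rewrite divff // gt_eqF.
have Ei0 : 0 < E^-1 by rewrite invr_gt0.
rewrite leNgt; apply/negP => lt.
have sle' : - s <= (E - E^-1) / 2 * (p * q).
  by apply: le_trans sle; rewrite -normrN ler_norm.
have : (p - E * q) * (p + E^-1 * q) <= 0.
  rewrite (_ : _ * _ = p ^+ 2 - (E - E^-1) * (p * q) - (E * E^-1) * q ^+ 2);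
    last by ring.
  by rewrite Ei pE; lra.
apply/negP; rewrite -ltNge mulr_gt0 ?subr_gt0 //.
have := mulr_ge0 (ltW Ei0) q0; have := mulr_ge0 (ltW E0) q0; lra.
Qed.

(** Changing the sign of the second row turns the matrix with rows [X, Y] and
    [- Y, Z] into a symmetric matrix [S] of trace [- 2 * u] and determinant
    [- 1].  By Cayley-Hamilton [S^2 = 1 - 2 * u * S], so
    [|S v|^2 = <v, S^2 v> = |v|^2 - 2 * u * <v, S v>], and Cauchy-Schwarz makes
    this a quadratic inequality in [|S v|]. *)
Lemma skew_sqnorm_le (R : realType) (X Y Z u th x y : R) :
  X * Z + Y ^+ 2 = 1 -> Z - X = 2 * u -> `|u| <= sinh th ->
  (X * x + Y * y) ^+ 2 + (- Y * x + Z * y) ^+ 2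
    <= expR th ^+ 2 * (x ^+ 2 + y ^+ 2).
Proof.
move=> det1 tr uth; set l := leLHS; set r := x ^+ 2 + y ^+ 2.
have l0 : 0 <= l by rewrite addr_ge0 ?sqr_ge0.
have r0 : 0 <= r by rewrite addr_ge0 ?sqr_ge0.
set s := u * (x * (X * x + Y * y) - y * (- Y * x + Z * y)).
rewrite -(sqr_sqrtr l0) -(sqr_sqrtr r0) -exprMn.
rewrite ler_pXn2r ?nnegrE ?mulr_ge0 ?sqrtr_ge0 ?expR_ge0 //.
apply: (@sqr_le_skew _ _ s); rewrite ?sqrtr_ge0 ?expR_gt0 //.
  rewrite -expRN -/(sinh th) -sqrtrM // normrM.
  apply: ler_pM => //; rewrite -sqrtr_sqr ler_sqrt ?mulr_ge0 //.
  have := sqr_ge0 (x * (- Y * x + Z * y) + y * (X * x + Y * y)).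
  by rewrite /l /r; lra.
rewrite !sqr_sqrtr // /l /r /s.
have ZE : Z = 2 * u + X by lra.
have h0 : X - Z = - 2 * u by lra.
have h1 : X ^+ 2 + Y ^+ 2 = 1 - 2 * u * X by move: det1; rewrite ZE; lra.
have h2 : Y ^+ 2 + Z ^+ 2 = 1 + 2 * u * Z by move: det1; rewrite ZE; lra.
transitivity ((X ^+ 2 + Y ^+ 2) * x ^+ 2 + (Y ^+ 2 + Z ^+ 2) * y ^+ 2
              + 2 * x * y * Y * (X - Z)); first by ring.
by rewrite h0 h1 h2; ring.
Qed.

(** The previous bound is strict on the first row: equality in Cauchy-Schwarz
    would make the first basis vector an eigenvector of [S], which [Y != 0]
    forbids, unless [u = 0]; but then the row has norm 1. *)
Lemma skew_row_lt (R : realType) (X Y Z u th : R) :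
  X * Z + Y ^+ 2 = 1 -> Z - X = 2 * u -> `|u| <= sinh th -> Y != 0 -> 0 < th ->
  X ^+ 2 + Y ^+ 2 < expR th ^+ 2.
Proof.
move=> det1 tr uth Y0 th0.
have ZE : Z = 2 * u + X by lra.
have h1 : X ^+ 2 + Y ^+ 2 = 1 - 2 * u * X by move: det1; rewrite ZE; lra.
have Y2 : 0 < Y ^+ 2 by rewrite exprn_even_gt0.
set r := Num.sqrt (X ^+ 2 + Y ^+ 2).
have r2 : r ^+ 2 = X ^+ 2 + Y ^+ 2 by rewrite sqr_sqrtr ?addr_ge0 ?sqr_ge0.
have r0 : 0 <= r := sqrtr_ge0 _.
have Xr : `|X| < r by rewrite -sqrtr_sqr ltr_sqrt ?ltrDl // ltr_wpDl ?sqr_ge0.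
have e1 : 1 < expR th by rewrite -expR0 ltr_expR.
have Ei : expR th * expR (- th) = 1 by rewrite -expRD subrr expR0.
have Ei0 : 0 < expR (- th) := expR_gt0 _.
rewrite -r2 ltr_pXn2r ?nnegrE ?expR_ge0 //.
(* [h1] and [uX] bound [r ^+ 2] by [1 + 2 * `|u| * `|X|]. *)
have uX : - (u * X) <= `|u| * `|X| by rewrite -normrM -normrN ler_norm.
move: uth; rewrite /sinh => uth.
have [u0|u0] := eqVneq u 0.
  have : r ^+ 2 = 1 by rewrite r2 h1 u0; ring.
  nra.
have u0' : 0 < `|u| by rewrite normr_gt0.
have : r ^+ 2 < 1 + (expR th - expR (- th)) * r by nra.
rewrite ltNge => /negP lt; rewrite ltNge; apply/negP => le; apply: lt.
nra.
Qed.

(** * Contraction over a cycle *)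

(** The flow of a Jordan block [- n] in a basis where its nilpotent part is not
    triangular: for [be * ga = al ^+ 2] the matrix with rows [- al, be] and
    [- ga, al] has square zero. *)
Definition shear_flow (R : realType) (n al be ga t : R) : 'M[R]_2 :=
  expR (- n * t) *: mx2 (1 - al * t) (be * t) (- ga * t) (1 + al * t).

Definition diag_flow (R : realType) (p q s : R) : 'M[R]_2 :=
  mx2 (expR (p * s)) 0 0 (expR (q * s)).

(** The second clause makes the contraction uniform over the cycles that stay
    away from the extreme one [(tau, eta)]; this is what convergence to [0]
    rests on. *)
Definition contracts (R : realType) (B D : R -> 'M[R]_2) (tau eta : R) : Prop :=
  (forall t s z, tau <= t -> 0 <= s <= eta ->
     sqnorm (D s *m (B t *m z)) <= sqnorm z) /\
  (forall delta, 0 < delta -> exists2 rho, 0 <= rho < 1 &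
     forall t s z, tau <= t -> 0 <= s <= eta ->
       tau + delta <= t \/ s <= eta - delta ->
       sqnorm (D s *m (B t *m z)) <= rho * sqnorm z).

Lemma sqnormZ (R : realType) (k : R) (z : 'cV[R]_2) :
  sqnorm (k *: z) = k ^+ 2 * sqnorm z.
Proof. by rewrite /sqnorm !mxE; ring. Qed.

Lemma sqnorm_diag (R : realType) (p q s : R) (z : 'cV[R]_2) :
  sqnorm (diag_flow p q s *m z) =
  expR (p * s) ^+ 2 * z ord0 ord0 ^+ 2 +
  expR (q * s) ^+ 2 * z ord_max ord0 ^+ 2.
Proof. by rewrite /sqnorm !mx2_mul_col; ring. Qed.

Lemma expR_sqr (R : realType) (x : R) : expR x ^+ 2 = expR (2 * x).
Proof. by rewrite expr2 -expRD mulrDl mul1r. Qed.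

Lemma sqnorm_diag_flow_le (R : realType) (p q s eta : R) (z : 'cV[R]_2) :
  p <= q -> 0 < q -> 0 <= s <= eta ->
  sqnorm (diag_flow p q s *m z) <= expR (2 * (q * eta)) * sqnorm z.
Proof.
move=> pq q0 /andP[s0 se].
rewrite sqnorm_diag [X in _ <= _ * X]/sqnorm mulrDr !expR_sqr.
by apply: lerD; rewrite ler_wpM2r ?sqr_ge0 // ler_expR; nra.
Qed.

(** With a nilpotent part of size [eps], the cycle has norm at most
    [expR (q * eta - n * t) * (1 + eps * t)], and
    [1 + eps * t <= expR (eps * t)].  The excess [eps0] of [tau] over
    [q / n * eta] absorbs the last factor when [eps] is small. *)
Lemma strict_shear_contracts (R : realType) (n p q be ga eta eps0 tau eps : R) :
  0 < n -> p <= q -> 0 < q -> 0 < eta -> 0 < eps0 ->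
  tau = q / n * eta + eps0 -> 0 <= be <= eps -> 0 <= ga <= eps ->
  be * ga = 0 -> eps <= n / 2 -> 2 * eps * tau <= n * eps0 ->
  contracts (shear_flow n 0 be ga) (diag_flow p q) tau eta.
Proof.
move=> n0 pq q0 eta0 e0 tauE /andP[be0 bee] /andP[ga0 gae] bega en etau.
have ntau : n * tau = q * eta + n * eps0.
  by rewrite tauE mulrDr mulrA (mulrC n (q / n)) divfK ?gt_eqF.
have tau0 : 0 < tau.
  by rewrite tauE addr_gt0 // mulr_gt0 // divr_gt0.
have eps_ge0 : 0 <= eps by lra.
have key t s z : tau <= t -> 0 <= s <= eta ->
    sqnorm (diag_flow p q s *m (shear_flow n 0 be ga t *m z))
    <= expR (- (n * eps0)) * sqnorm z.
  move=> tt /andP[s0 se]; have t0 : 0 <= t by lra.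
  have ss : 0 <= s <= eta by rewrite s0.
  apply: le_trans (sqnorm_diag_flow_le _ pq q0 ss) _.
  rewrite /shear_flow -scalemxAl sqnormZ mulrA expR_sqr.
  have le2 : sqnorm (mx2 (1 - 0 * t) (be * t) (- ga * t) (1 + 0 * t) *m z)
      <= expR (2 * (eps * t)) * sqnorm z.
    apply: (@le_trans _ _ ((1 + eps * t) ^+ 2 * sqnorm z)); last first.
      rewrite ler_wpM2r ?sqnorm_ge0 // -expR_sqr ler_pXn2r ?nnegrE ?expR_ge0 //.
        exact: expR_ge1Dx.
      by rewrite addr_ge0 // mulr_ge0.
    rewrite /sqnorm !mx2_mul_col.
    move: (z ord0 ord0) (z ord_max ord0) => x y.
    have et0 : 0 <= eps * t by rewrite mulr_ge0.
    have shear_le (g v w : R) : 0 <= g <= eps * t ->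
        (v + g * w) ^+ 2 + w ^+ 2 <= (1 + eps * t) ^+ 2 * (v ^+ 2 + w ^+ 2) /\
        (v - g * w) ^+ 2 + w ^+ 2 <= (1 + eps * t) ^+ 2 * (v ^+ 2 + w ^+ 2).
      move=> /andP[g0 ge].
      have v2 := sqr_ge0 v; have w2 := sqr_ge0 w.
      have step : (1 + g) ^+ 2 * (v ^+ 2 + w ^+ 2)
          <= (1 + eps * t) ^+ 2 * (v ^+ 2 + w ^+ 2).
        by rewrite ler_wpM2r ?addr_ge0 // ler_pXn2r ?nnegrE //; lra.
      have vw1 := mulr_ge0 g0 (sqr_ge0 (v - w)).
      have vw2 := mulr_ge0 g0 (sqr_ge0 (v + w)).
      have gv2 := mulr_ge0 (sqr_ge0 g) v2.
      have gv := mulr_ge0 g0 v2; have gw := mulr_ge0 g0 w2.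
      by split; apply: le_trans step; lra.
    have bt : 0 <= be * t <= eps * t by rewrite mulr_ge0 // ler_wpM2r.
    have gt : 0 <= ga * t <= eps * t by rewrite mulr_ge0 // ler_wpM2r.
    move/eqP: bega; rewrite mulf_eq0 => /orP[/eqP b0|/eqP g0].
      have [_] := shear_le _ y x gt.
      by rewrite b0; lra.
    have [+ _] := shear_le _ x y bt.
    by rewrite g0; lra.
  apply: (@le_trans _ _ (expR (2 * (q * eta)) * expR (2 * (- n * t)) *
      (expR (2 * (eps * t)) * sqnorm z))).
    by rewrite ler_wpM2l // mulr_ge0 ?expR_ge0.
  rewrite mulrA -!expRD ler_wpM2r ?sqnorm_ge0 // ler_expR.
  have : (n - eps) * tau <= (n - eps) * t by rewrite ler_wpM2l //; lra.
  lra.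
have rho1 : expR (- (n * eps0)) < 1.
  by rewrite -expR0 ltr_expR oppr_lt0 mulr_gt0.
split=> [t s z tt ss|delta d0].
  apply: le_trans (key _ _ _ tt ss) _.
  by rewrite ler_piMl ?sqnorm_ge0 // ltW.
exists (expR (- (n * eps0))); first by rewrite expR_ge0.
by move=> t s z tt ss _; exact: key.
Qed.

(** The off-diagonal entries of the shear are chosen for the extreme cycle
    [s = eta] with [p] replaced by its positive part: multiplied by
    [diag (expR (C - m), expR (C + m))], the shear flow becomes
    [expR (C - n * t)] times the matrix with rows [X t, Y t] and [- Y t, Z t],
    to which [skew_sqnorm_le] applies.  A shorter mode 2 only contributes the
    factors [c0 s] and [c1 s], which are at most 1. *)
Section margin_contracts.
Context (R : realType) (n p q al m C eta tau : R).
Context (al0 : al != 0) (q0 : 0 < q).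
Context (Cpm : 0 <= C - m) (pCm : p * eta <= C - m) (qCm : q * eta = C + m).
Context (margin : dwell_margin (fun t => sinh m + al * t * cosh m) n C tau).

Let B := shear_flow n al (`|al| * expR m) (`|al| * expR (- m)).
Let D := diag_flow p q.
Let X (t : R) := expR (- m) * (1 - al * t).
Let Y (t : R) := `|al| * t.
Let Z (t : R) := expR m * (1 + al * t).
Let u (t : R) := sinh m + al * t * cosh m.

Let em : expR m * expR (- m) = 1.
Proof. by rewrite -expRD subrr expR0. Qed.

Let detXYZ t : X t * Z t + Y t ^+ 2 = 1.
Proof.
rewrite /X /Y /Z exprMn real_normK ?num_real //.
by transitivity (expR m * expR (- m) * (1 - (al * t) ^+ 2) + al ^+ 2 * t ^+ 2);
  [ring|rewrite em; ring].
Qed.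

Let trXZ t : Z t - X t = 2 * u t.
Proof. by rewrite /Z /X /u /sinh /cosh; field. Qed.

Let c0 (s : R) := expR (p * s - (C - m)).
Let c1 (s : R) := expR (q * s - (C + m)).

Let c0_le1 (s : R) : 0 <= s <= eta -> c0 s ^+ 2 <= 1.
Proof.
move=> /andP[s0 se]; rewrite exprn_ile1 ?expR_ge0 // -expR0 ler_expR.
rewrite subr_le0.
have [p0|p0] := leP 0 p; first by apply: le_trans pCm; rewrite ler_wpM2l.
by apply: le_trans Cpm; rewrite nmulr_rle0.
Qed.

Let c1_le (d s : R) : s <= eta - d -> c1 s ^+ 2 <= expR (- (q * d)) ^+ 2.
Proof.
move=> se; rewrite ler_pXn2r ?nnegrE ?expR_ge0 // ler_expR.
by rewrite -qCm lerBlDr -mulrN -mulrDr addrC ler_pM2l.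
Qed.

Let cycleE t s z : sqnorm (D s *m (B t *m z)) =
  expR (C - n * t) ^+ 2 *
  (c0 s ^+ 2 * (X t * z ord0 ord0 + Y t * z ord_max ord0) ^+ 2 +
   c1 s ^+ 2 * (- Y t * z ord0 ord0 + Z t * z ord_max ord0) ^+ 2).
Proof.
rewrite /D sqnorm_diag /B /shear_flow -scalemxAl.
have scE (k : R) (v : 'cV[R]_2) i : (k *: v) i ord0 = k * v i ord0.
  by rewrite mxE.
rewrite !scE !mx2_mul_col /X /Y /Z.
move: (z ord0 ord0) (z ord_max ord0) => x y.
have -> : expR (p * s) = c0 s * (expR C * expR (- m)).
  by rewrite -!expRD; congr expR; ring.
have -> : expR (q * s) = c1 s * (expR C * expR m).
  by rewrite -!expRD; congr expR; ring.
have -> : expR (C - n * t) = expR C * expR (- n * t) by rewrite mulNr -expRD.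
have -> : expR (- m) = (expR m)^-1 by rewrite expRN.
by field; rewrite expR_eq0.
Qed.

Let row_bound t (z : 'cV[R]_2) :
  (X t * z ord0 ord0 + Y t * z ord_max ord0) ^+ 2
  <= (X t ^+ 2 + Y t ^+ 2) * sqnorm z.
Proof.
rewrite /sqnorm; move: (X t) (Y t) (z ord0 ord0) (z ord_max ord0) => a b x y.
by have := sqr_ge0 (a * y - b * x); lra.
Qed.

Let rows_bound t th (z : 'cV[R]_2) : `|u t| <= sinh th ->
  (X t * z ord0 ord0 + Y t * z ord_max ord0) ^+ 2 +
  (- Y t * z ord0 ord0 + Z t * z ord_max ord0) ^+ 2 <= expR th ^+ 2 * sqnorm z.
Proof. exact: skew_sqnorm_le. Qed.

Let theta_le t : tau <= t -> `|u t| <= sinh (n * t - C).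
Proof.
case: margin => [_ _ at_tau gap]; rewrite le_eqVlt => /orP[/eqP<- //|tt].
have d0 : 0 < t - tau by rewrite subr_gt0.
have [kappa k0 /(_ t)] := gap _ d0.
rewrite addrC subrK => /(_ (lexx _)) h; apply: le_trans h _.
by rewrite ler_sinh lerBlDr lerDl ltW.
Qed.

Let expR_scale t th : expR (C - n * t) ^+ 2 * expR th ^+ 2
  = expR (2 * (C - n * t + th)).
Proof. by rewrite -exprMn -expRD expR_sqr. Qed.

Let E_ge0 t : 0 <= expR (C - n * t) ^+ 2.
Proof. by rewrite sqr_ge0. Qed.

Let c1_le1 s : 0 <= s <= eta -> c1 s ^+ 2 <= 1.
Proof.
move=> /andP[_ se]; rewrite -[eta]subr0 in se.
by apply: le_trans (c1_le se) _; rewrite mulr0 oppr0 expR0 expr1n.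
Qed.

Let cycle_le t s th z : 0 <= s <= eta -> `|u t| <= sinh th ->
  sqnorm (D s *m (B t *m z)) <= expR (2 * (C - n * t + th)) * sqnorm z.
Proof.
move=> ss uth; rewrite cycleE -expR_scale -mulrA ler_wpM2l //.
apply: le_trans (rows_bound z uth).
apply: lerD; apply: ler_piMl;
  [exact: sqr_ge0|exact: c0_le1|exact: sqr_ge0|exact: c1_le1].
Qed.

(** The square norm of the first row of the extreme cycle.  It matters because,
    when [C = m], [c0 s] is not bounded away from 1 for small [s]: a short
    mode 2 then contracts the second coordinate only. *)
Let row t := expR (C - n * t) ^+ 2 * (X t ^+ 2 + Y t ^+ 2).

Let row_lt1 : row tau < 1.
Proof.
case: margin => tau0 th0 at_tau _.
have Y0 : Y tau != 0 by rewrite mulf_neq0 ?normr_eq0 // gt_eqF.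
have lt := skew_row_lt (detXYZ tau) (trXZ tau) at_tau Y0 th0.
apply: (@lt_le_trans _ _ (expR (C - n * tau) ^+ 2 * expR (n * tau - C) ^+ 2)).
  by rewrite ltr_pM2l // exprn_gt0 ?expR_gt0.
by rewrite expR_scale (_ : C - _ + _ = 0) ?mulr0 ?expR0 //; ring.
Qed.

Let continuous_row : continuous row.
Proof.
move=> t.
have lin (a b : R) : (fun t : R => a - b * t) x @[x --> t] --> a - b * t.
  by apply: cvgB; [exact: cvg_cst|apply: cvgMr; exact: cvg_id].
apply: cvgM.
  apply: (@continuous_comp R R R (fun t => expR (C - n * t)) (fun x => x ^+ 2));
    last exact: exprn_continuous.
  apply: (@continuous_comp R R R (fun t => C - n * t) expR);
    last exact: continuous_expR.
  exact: lin.
apply: cvgD; apply: (@continuous_comp R R R _ (fun x => x ^+ 2));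
  try exact: exprn_continuous.
- by apply: cvgMr; exact: lin.
- by apply: cvgMr; exact: cvg_id.
Qed.

(** Mode 1 times bounded away from [tau] contract by the margin of [tau].
    Near [tau], a mode 2 time at most [eta - delta] multiplies the square of
    the second coordinate of the image by at most [r1 < 1], while the first
    coordinate is governed by the first row, whose norm is below 1 at [tau] and
    hence nearby. *)
Lemma margin_contracts : contracts B D tau eta.
Proof.
split=> [t s z tt ss|delta d0].
  apply: le_trans (cycle_le z ss (theta_le tt)) _.
  by rewrite (_ : C - _ + _ = 0) ?mulr0 ?expR0 ?mul1r //; ring.
have [d' d'0 near_row] : exists2 d', 0 < d' &
    forall t, tau <= t -> t < tau + d' -> row t <= (1 + row tau) / 2.
  have lt : row tau < (1 + row tau) / 2 by have := row_lt1; lra.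
  have /nbhs_ballP[e /= e0 sub] :
      \forall t \near nbhs tau, row t <= (1 + row tau) / 2.
    by apply: cvgr_le lt; exact: continuous_row.
  exists e => // t t1 t2; apply: sub; rewrite /ball /= ltr_norml; lra.
pose d := Num.min delta d'.
have dpos : 0 < d by rewrite lt_min d0.
case: margin => _ _ _ /(_ _ dpos)[kappa k0 gap].
set r0 := (1 + row tau) / 2.
set r1 := expR (- (q * delta)) ^+ 2.
have row0 : 0 <= row tau by rewrite mulr_ge0 // addr_ge0 ?sqr_ge0.
have r01 : 0 <= r0 < 1 by have := row_lt1; rewrite /r0; lra.
have r11 : 0 <= r1 < 1.
  by rewrite sqr_ge0 exprn_ilt1 ?expR_ge0 // -expR0 ltr_expR oppr_lt0 mulr_gt0.
exists (Num.max (expR (- 2 * kappa)) ((1 - r1) * r0 + r1)).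
  have e1 : expR (- 2 * kappa) < 1.
    by rewrite -expR0 ltr_expR mulNr oppr_lt0 mulr_gt0.
  by rewrite le_max expR_ge0 gt_max e1 /=; nra.
move=> t s z tt ss cases.
have [far|close] := leP (tau + d) t.
  apply: le_trans (cycle_le z ss (gap _ far)) _.
  rewrite ler_wpM2r ?sqnorm_ge0 // le_max ler_expR.
  by apply/orP; left; lra.
have se : s <= eta - delta.
  case: cases => // tfar; move: close; rewrite ltNge => /negP[].
  by apply: le_trans tfar; rewrite lerD2l ge_min lexx.
have rowt : row t <= r0.
  apply: near_row => //; apply: lt_le_trans close _.
  by rewrite lerD2l ge_min lexx orbT.
have rows : expR (C - n * t) ^+ 2 *
  ((X t * z ord0 ord0 + Y t * z ord_max ord0) ^+ 2 +
   (- Y t * z ord0 ord0 + Z t * z ord_max ord0) ^+ 2) <= sqnorm z.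
  apply: le_trans (ler_wpM2l (E_ge0 t) (rows_bound z (theta_le tt))) _.
  by rewrite mulrA expR_scale (_ : C - _ + _ = 0) ?mulr0 ?expR0 ?mul1r //; ring.
have row1 : expR (C - n * t) ^+ 2 *
    (X t * z ord0 ord0 + Y t * z ord_max ord0) ^+ 2 <= r0 * sqnorm z.
  apply: le_trans (ler_wpM2l (E_ge0 t) (row_bound t z)) _.
  by rewrite mulrA ler_wpM2r ?sqnorm_ge0.
(* Write g + r1 h as (1 - r1) g + r1 (g + h), with g and h the squares of the
   two coordinates of the image. *)
apply: (@le_trans _ _ (((1 - r1) * r0 + r1) * sqnorm z)); last first.
  by rewrite ler_wpM2r ?sqnorm_ge0 // le_max lexx orbT.
rewrite cycleE.
have c0s := c0_le1 ss; have c1s : c1 s ^+ 2 <= r1 := c1_le se.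
move: rows row1; set E := expR _ ^+ 2; set g := (X t * _ + _) ^+ 2.
set h := (_ + Z t * _) ^+ 2 => rows row1.
have Eg : 0 <= E * g by rewrite mulr_ge0 ?sqr_ge0.
have Eh : 0 <= E * h by rewrite mulr_ge0 ?sqr_ge0.
have e1 : c0 s ^+ 2 * (E * g) <= E * g by rewrite ler_piMl.
have e2 : c1 s ^+ 2 * (E * h) <= r1 * (E * h) by rewrite ler_wpM2r.
have e3 : r1 * (E * (g + h)) <= r1 * sqnorm z.
  by apply: ler_wpM2l => //; case/andP: r11.
have e4 : (1 - r1) * (E * g) <= (1 - r1) * (r0 * sqnorm z).
  by apply: ler_wpM2l => //; case/andP: r11; lra.
lra.
Qed.

End margin_contracts.

(** * Solutions on a segment where the mode is constant *)

(** The product of [g] with [expR (- lam * t)] has derivative zero. *)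
Lemma linear_ode (R : realType) (g : R -> R) (lam r s : R) : r <= s ->
  {within `[r, s], continuous g} ->
  (forall t, r < t < s -> is_derive t 1 g (lam * g t)) ->
  g s = expR (lam * (s - r)) * g r.
Proof.
move=> rs cg dg.
pose h : R -> R := fun t => expR (- lam * t) * g t.
have dE (t : R) :
    is_derive t 1 (fun t => expR (- lam * t)) (expR (- lam * t) * - lam).
  apply: (@is_derive1_comp _ expR (fun t => - lam * t)).
  have := is_deriveZ (- lam) (is_derive_id t 1); rewrite /GRing.scale /= mulr1.
  exact.
have dh t : t \in `]r, s[ -> is_derive t 1 h ((fun=> 0) t).
  rewrite in_itv => /dg dgt.
  apply: (is_derive_eq (is_deriveM (dE t) dgt)).
  by rewrite /GRing.scale /=; ring.
have ch : {within `[r, s], continuous h}.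
  move=> t; apply: cvgM; last exact: cg.
  apply: continuous_subspaceT => u.
  by apply/differentiable_continuous/derivable1_diffP; case: (dE u).
have [c _] := MVT_segment rs dh ch.
rewrite mul0r => /subr0_eq; rewrite /h => e.
have := congr1 (fun x => expR (lam * s) * x) e.
rewrite !mulrA -!expRD mulNr subrr expR0 mul1r => ->; congr (expR _ * _); ring.
Qed.

Section coordinate.
Context (R : realType) (L : 'M[R]_2) (i : 'I_2).

Let coordE (z : 'cV[R]_2) :
  (L *m z) i ord0 = L i ord0 * z ord0 ord0 + L i ord_max * z ord_max ord0.
Proof.
rewrite !mxE !big_ord_recl big_ord0 addr0.
by congr (_ + L _ _ * z _ _); apply/val_inj.
Qed.

Lemma is_derive_coordinate (x : R -> 'cV[R]_2) (t : R) (v : 'cV[R]_2) :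
  is_derive t 1 x v ->
  is_derive t 1 (fun t => (L *m x t) i ord0) ((L *m v) i ord0).
Proof.
move=> dx.
have entry (j : 'I_2) : is_derive t 1 (fun t => x t j ord0) (v j ord0).
  have dxt : derivable x t 1 by case: dx.
  apply: DeriveDef; first by move/derivable_mxP: dxt; exact.
  by have := derive_mx dxt; rewrite derive_val => ->; rewrite mxE.
under eq_fun do rewrite coordE.
rewrite coordE.
apply: is_deriveD; apply: is_deriveZ; exact: entry.
Qed.

Lemma continuous_coordinate : continuous (fun z : 'cV[R]_2 => (L *m z) i ord0).
Proof.
rewrite (funext coordE : (fun z => (L *m z) i ord0) = _).
move=> z.
have entry (c : R) j : {for z, continuous (fun z : 'cV[R]_2 => c * z j ord0)}.
  have cz : {for z, continuous (fun z : 'cV[R]_2 => z j ord0)}.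
    exact: coord_continuous.
  exact: cvgM (cvg_cst c) cz.
exact: cvgD (entry _ _) (entry _ _).
Qed.

End coordinate.

Definition segment_solution (R : realType) (A : 'M[R]_2) (r s : R)
    (x : R -> 'cV[R]_2) : Prop :=
  {within `[r, s], continuous x} /\
  forall t, r < t < s -> is_derive t 1 x (A *m x t).

Lemma segment_solution_coordinate (R : realType) (L A J : 'M[R]_2) (r s : R)
    (x : R -> 'cV[R]_2) (i : 'I_2) :
  L *m A = J *m L -> segment_solution A r s x ->
  {within `[r, s], continuous (fun t => (L *m x t) i ord0)} /\
  forall t, r < t < s -> is_derive t 1 (fun t => (L *m x t) i ord0)
    ((J *m (L *m x t)) i ord0).
Proof.
move=> LA [cx dx]; split=> [t|t rts].
  exact: (continuous_comp (cx t) (@continuous_coordinate R L i (x t))).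
by rewrite mulmxA -LA -mulmxA; apply: is_derive_coordinate; exact: dx.
Qed.

Lemma col2P (R : realType) (z w : 'cV[R]_2) :
  z ord0 ord0 = w ord0 ord0 -> z ord_max ord0 = w ord_max ord0 -> z = w.
Proof.
move=> e0 e1; apply/matrixP => i j; rewrite !ord1.
case: i => [[|[|//]] ?]; [move: e0|move: e1];
  by congr (z _ _ = w _ _); apply/val_inj.
Qed.

Lemma diag_flow_solution (R : realType) (L A : 'M[R]_2) (p q r s : R)
    (x : R -> 'cV[R]_2) :
  r <= s -> L *m A = mx2 p 0 0 q *m L -> segment_solution A r s x ->
  L *m x s = diag_flow p q (s - r) *m (L *m x r).
Proof.
move=> rs LA sol.
have [c0 d0] := segment_solution_coordinate ord0 LA sol.
have [c1 d1] := segment_solution_coordinate ord_max LA sol.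
apply: col2P; rewrite mx2_mul_col.
  rewrite mul0r addr0.
  apply: (@linear_ode _ (fun t => (L *m x t) ord0 ord0)) => // t /d0.
  by rewrite mx2_mul_col mul0r addr0.
rewrite mul0r add0r.
apply: (@linear_ode _ (fun t => (L *m x t) ord_max ord0)) => // t /d1.
by rewrite mx2_mul_col mul0r add0r.
Qed.

(** The second coordinate [y1] solves a scalar equation, and so does
    [y0 - (t - r) * y1], with the same rate [- n]: no exponential of a
    matrix is needed. *)
Lemma jordan_flow_solution (R : realType) (L A : 'M[R]_2) (n r s : R)
    (x : R -> 'cV[R]_2) :
  r <= s -> L *m A = mx2 (- n) 1 0 (- n) *m L -> segment_solution A r s x ->
  L *m x s = expR (- n * (s - r)) *: mx2 1 (s - r) 0 1 *m (L *m x r).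
Proof.
move=> rs LA sol.
have [c0 d0] := segment_solution_coordinate ord0 LA sol.
have [c1 d1] := segment_solution_coordinate ord_max LA sol.
pose y0 t := (L *m x t) ord0 ord0; pose y1 t := (L *m x t) ord_max ord0.
have e1 : y1 s = expR (- n * (s - r)) * y1 r.
  apply: (@linear_ode _ y1) => // t /d1.
  by rewrite mx2_mul_col mul0r add0r.
have lin (t : R) : is_derive t 1 (fun t => t - r) 1.
  by have := is_deriveB (is_derive_id t 1) (is_derive_cst r t 1); rewrite subr0.
pose v t := y0 t - (t - r) * y1 t.
have e0 : v s = expR (- n * (s - r)) * v r.
  apply: (@linear_ode _ v) => // [t|t rts].
    apply: cvgB; first exact: c0.
    have clin : {within `[r, s], continuous (fun t : R => t - r)}.
      apply: continuous_subspaceT => u.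
      by apply: cvgB; [exact: cvg_id|exact: cvg_cst].
    by apply: cvgM; [exact: clin|exact: c1].
  apply: (is_derive_eq (is_deriveB (d0 t rts) (is_deriveM (lin t) (d1 t rts)))).
  by rewrite !mx2_mul_col /GRing.scale /= /v /y0 /y1; ring.
rewrite -scalemxAl; apply: col2P; rewrite [RHS]mxE mx2_mul_col.
  move: e0; rewrite /v subrr mul0r subr0 -/(y0 r) -/(y0 s) -/(y1 r) e1 => e0.
  have -> : y0 s = y0 s - (s - r) * (expR (- n * (s - r)) * y1 r) +
    (s - r) * (expR (- n * (s - r)) * y1 r) by ring.
  by rewrite e0; ring.
by rewrite -/(y1 r) -/(y1 s) e1; ring.
Qed.

(** * Switched trajectories *)

Section signal.
Context (R : realType) (sigma : R -> mode) (sw : nat -> R).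
Context (swP : switching_times sigma sw).

Lemma switching_times_le i j : (i <= j)%N -> sw i <= sw j.
Proof.
case: swP => _ lt _ _ _ ij; rewrite -(subnKC ij).
elim: (j - i)%N => [|d IH]; first by rewrite addn0.
by rewrite addnS (le_trans IH) // ltW.
Qed.

Lemma switching_times_ge0 i : 0 <= sw i.
Proof. by case: swP => sw0 _ _ _ _; rewrite -sw0 switching_times_le. Qed.

Lemma signal_modes k : sigma 0 = mode1 ->
  sigma (sw k.*2) = mode1 /\ sigma (sw k.*2.+1) = mode2.
Proof.
case: swP => sw0 _ _ _ alt s0.
have flip m : m <> mode1 -> m = mode2 by case: m.
have flip' m : m <> mode2 -> m = mode1 by case: m.
elim: k => [|k [_ IH2]].
  have e : sigma (sw 0.*2) = mode1 by rewrite sw0.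
  by split=> //; apply: flip; rewrite -[X in _ <> X]e; exact: alt.
have e : sigma (sw k.+1.*2) = mode1.
  by apply: flip'; rewrite -[X in _ <> X]IH2; exact: alt.
by split=> //; apply: flip; rewrite -[X in _ <> X]e; exact: alt.
Qed.

Lemma cycle_index t : 0 <= t -> exists k, sw k.*2 <= t < sw k.+1.*2.
Proof.
move=> t0; case: swP => sw0 _ /cvgryPgt /(_ t)[N _ Nt] _ _.
have ex : exists k, t < sw k.*2.
  exists N; apply: lt_le_trans (Nt N (leqnn N)) _.
  by apply: switching_times_le; rewrite -addnn leq_addr.
case: (ex_minnP ex) => -[|k] tk kmin; first by move: tk; rewrite sw0 ltNge t0.
exists k; rewrite tk andbT leNgt; apply/negP => /kmin.
by rewrite ltnn.
Qed.

Lemma segment_solution_signal (A1 A2 : 'M[R]_2) x i t :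
  is_solution A1 A2 sigma x -> sw i <= t <= sw i.+1 ->
  segment_solution (active A1 A2 (sigma (sw i))) (sw i) t x.
Proof.
move=> [cx dx] /andP[it ti]; split.
  apply: continuous_subspaceW cx => u /=; rewrite !in_itv /= andbT => /andP[iu _].
  exact: le_trans (switching_times_ge0 i) iu.
case: swP => _ _ _ cst _.
move=> u /andP[iu ut].
have ui : u < sw i.+1 := lt_le_trans ut ti.
have eu : sigma u = sigma (sw i) by apply: cst; rewrite ui ltW.
rewrite -eu; apply: dx; first exact: le_lt_trans (switching_times_ge0 i) iu.
near=> s; rewrite eu; apply: cst.
have /andP[ls si] : sw i < s < sw i.+1.
  near: s; have : u \in `]sw i, sw i.+1[ by rewrite in_itv /= iu.
  by move=> /near_in_itvoo; apply: filterS => s; rewrite in_itv.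
by rewrite si ltW.
Unshelve. all: by end_near. Qed.

End signal.

(** As [t k] is bounded below by [tau] and [s k] above by [eta], the pair can
    fail to converge to [(tau, eta)] in these two ways only. *)
Lemma frequently_off (R : realType) (t s : nat -> R) (tau eta : R) :
  (forall k, tau <= t k /\ s k <= eta) ->
  ~ ((t k, s k) @[k --> \oo] --> ((tau, eta) : R * R)) ->
  exists2 delta, 0 < delta &
    forall N, exists2 k, (N <= k)%N & tau + delta <= t k \/ s k <= eta - delta.
Proof.
move=> ts; apply: contra_notP => H.
have close delta : 0 < delta -> \forall k \near \oo,
    t k < tau + delta /\ eta - delta < s k.
  move=> d0; apply: contrapT => far; apply: H; exists delta => // N.
  apply: contrapT => none; apply: far; exists N => // k /= Nk.
  by split; rewrite ltNge; apply/negP => le; apply: none; exists k => //;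
    [left|right].
apply: (cvg_pair (G := nbhs tau) (H := nbhs eta) (f := t) (g := s));
  apply/cvgrPdist_lt => e e0; apply: filterS (close e e0) => k [k1 k2];
  have [k3 k4] := ts k; rewrite ltr_norml; lra.
Qed.

Lemma frequent_contraction (R : realType) (v : nat -> R) (rho : R) :
  0 <= rho -> (forall k, 0 <= v k) -> (forall k, v k.+1 <= v k) ->
  (forall N, exists2 k, (N <= k)%N & v k.+1 <= rho * v k) ->
  forall n, exists N, forall k, (N <= k)%N -> v k <= rho ^+ n * v 0%N.
Proof.
move=> r0 v0 decr freq.
have mono i j : (i <= j)%N -> v j <= v i.
  move=> ij; rewrite -(subnKC ij); elim: (j - i)%N => [|d IH].
    by rewrite addn0.
  by rewrite addnS (le_trans (decr _)).
elim=> [|n [N IH]]; first by exists 0%N => k _; rewrite mul1r mono.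
have [k Nk vk] := freq N; exists k.+1 => j kj.
apply: le_trans (mono _ _ kj) (le_trans vk _).
by rewrite exprS -mulrA ler_wpM2l // IH.
Qed.

(** Stability in the coordinates [Q *m x], where a cycle is a contraction: the
    norm at the beginning of the cycles does not increase, and it grows by a
    bounded factor within a cycle. *)
Section stability.
Context (R : realType) (A1 A2 Q : 'M[R]_2) (B D : R -> 'M[R]_2) (tau eta : R).
Context (Q_unit : Q \in unitmx) (tau0 : 0 <= tau).
Context (flow1 : forall r s x, r <= s -> segment_solution A1 r s x ->
  Q *m x s = B (s - r) *m (Q *m x r)).
Context (flow2 : forall r s x, r <= s -> segment_solution A2 r s x ->
  Q *m x s = D (s - r) *m (Q *m x r)).
Context (K1 K2 : R) (K1_ge0 : 0 <= K1) (K2_ge0 : 0 <= K2).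
Context (boundB : forall t z, 0 <= t -> sqnorm (B t *m z) <= K1 * sqnorm z).
Context (boundD : forall s z, 0 <= s <= eta ->
  sqnorm (D s *m z) <= K2 * sqnorm z).
Context (ctr : contracts B D tau eta).

Let K12_ge0 : 0 <= K1 + K2 * K1.
Proof. by rewrite addr_ge0 // mulr_ge0. Qed.

Section trajectory.
Context (sigma : R -> mode) (sw : nat -> R) (x : R -> 'cV[R]_2).
Context (swP : switching_times sigma sw) (s0 : sigma 0 = mode1).
Context (dwell : forall k, tau <= dwell1 sw k /\ dwell2 sw k <= eta).
Context (sol : is_solution A1 A2 sigma x).

Let v k := sqnorm (Q *m x (sw k.*2)).

Let sw_lt k : sw k <= sw k.+1.
Proof. by rewrite (switching_times_le swP). Qed.

Let in1 k t : sw k.*2 <= t <= sw k.*2.+1 ->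
  Q *m x t = B (t - sw k.*2) *m (Q *m x (sw k.*2)).
Proof.
move=> tk; have := segment_solution_signal swP sol tk.
rewrite (signal_modes swP k s0).1 => /flow1; apply.
by case/andP: tk.
Qed.

Let in2 k t : sw k.*2.+1 <= t <= sw k.*2.+2 ->
  Q *m x t = D (t - sw k.*2.+1) *m (B (dwell1 sw k) *m (Q *m x (sw k.*2))).
Proof.
move=> tk; have := segment_solution_signal swP sol tk.
rewrite (signal_modes swP k s0).2 => /flow2 ->; last by case/andP: tk.
by rewrite (@in1 k) // lexx sw_lt.
Qed.

Let cycleE k : Q *m x (sw k.+1.*2) =
  D (dwell2 sw k) *m (B (dwell1 sw k) *m (Q *m x (sw k.*2))).
Proof. by rewrite doubleS (@in2 k) // lexx sw_lt. Qed.

Let dwell2_in k : 0 <= dwell2 sw k <= eta.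
Proof. by rewrite (dwell k).2 subr_ge0 sw_lt. Qed.

Let v_decr k : v k.+1 <= v k.
Proof. by rewrite /v cycleE; apply: ctr.1 => //; exact: (dwell k).1. Qed.

Let within_cycle k t : sw k.*2 <= t < sw k.+1.*2 ->
  sqnorm (Q *m x t) <= (K1 + K2 * K1) * v k.
Proof.
move=> /andP[kt tk].
have [le|lt] := leP t (sw k.*2.+1).
  rewrite (@in1 k) ?kt // (le_trans (boundB _ _)) ?subr_ge0 //.
  by rewrite ler_wpM2r ?sqnorm_ge0 // lerDl mulr_ge0.
rewrite (@in2 k) ?(ltW lt) ?(ltW tk) //.
have bd : 0 <= t - sw k.*2.+1 <= eta.
  rewrite subr_ge0 (ltW lt) /=; apply: le_trans (dwell k).2.
  by rewrite lerD2r ltW.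
apply: le_trans (boundD _ bd) _; rewrite mulrDl -mulrA.
apply: (@le_trans _ _ (K2 * (K1 * v k))); last first.
  by rewrite lerDr mulr_ge0 ?sqnorm_ge0.
by rewrite ler_wpM2l // boundB // (le_trans tau0) ?(dwell k).1.
Qed.

Lemma trajectory_bounded t : 0 <= t ->
  sqnorm (Q *m x t) <= (K1 + K2 * K1) * sqnorm (Q *m x 0).
Proof.
move=> t0; have [k tk] := cycle_index swP t0.
apply: le_trans (within_cycle tk) _.
rewrite ler_wpM2l //.
have -> : sqnorm (Q *m x 0) = v 0%N by case: swP => sw00 _ _ _ _; rewrite /v sw00.
by elim: k {tk} => // k IH; apply: le_trans IH.
Qed.

(** Infinitely many cycles stay [delta]-away from [(tau, eta)], and each of
    them gains the same factor [rho < 1]. *)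
Lemma trajectory_vanishes (e : R) : 0 < e ->
  ~ ((dwell1 sw k, dwell2 sw k) @[k --> \oo] --> ((tau, eta) : R * R)) ->
  exists M, forall t, M <= t -> sqnorm (Q *m x t) < e.
Proof.
move=> e0 /(frequently_off dwell)[delta d0 freq].
have [rho /andP[r0 r1] gap] := ctr.2 _ d0.
have freq' N : exists2 k, (N <= k)%N & v k.+1 <= rho * v k.
  have [k Nk off] := freq N; exists k => //.
  by rewrite /v cycleE; apply: gap => //; exact: (dwell k).1.
have decay := frequent_contraction r0 (fun k => sqnorm_ge0 _) v_decr freq'.
have K0 : 0 <= (K1 + K2 * K1) * v 0%N by rewrite mulr_ge0 // sqnorm_ge0.
have [n small] : exists n, rho ^+ n * ((K1 + K2 * K1) * v 0%N) < e.
  have r1' : `|rho| < 1 by rewrite ger0_norm.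
  have p0 : 0 < e / ((K1 + K2 * K1) * v 0%N + 1) by rewrite divr_gt0 // ltr_wpDl.
  have /cvgrPdist_lt/(_ _ p0)[n _ /(_ n (leqnn n))] := cvg_expr r1'.
  rewrite /= sub0r normrN ger0_norm ?exprn_ge0 // ltr_pdivlMr ?ltr_wpDl // => lt.
  exists n; apply: le_lt_trans lt; rewrite ler_wpM2l ?exprn_ge0 // lerDl //.
have [N decayN] := decay n.
exists (sw N.*2) => t Nt.
have t0 : 0 <= t := le_trans (switching_times_ge0 swP _) Nt.
have [k tk] := cycle_index swP t0.
have Nk : (N <= k)%N.
  rewrite leqNgt; apply/negP => kN; case/andP: tk => _; rewrite ltNge => /negP[].
  by apply: le_trans Nt; rewrite (switching_times_le swP) // leq_double.
apply: le_lt_trans (within_cycle tk) _; apply: le_lt_trans small.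
rewrite mulrCA ler_wpM2l //; exact: decayN.
Qed.

End trajectory.

Lemma contracts_stable sigma : sigma \in signals tau eta -> stable A1 A2 sigma.
Proof.
rewrite inE => -[sw [swP s0 dwell]] e e0.
have [Ki Ki0 boundi] := sqnorm_mul_le (invmx Q).
have [K K0 boundQ] := sqnorm_mul_le Q.
pose L := Ki * ((K1 + K2 * K1) * K) + 1.
have L0 : 0 < L.
  by rewrite ltr_wpDl // mulr_ge0 ?(ltW Ki0) // mulr_ge0 // ltW.
exists (e / Num.sqrt L); first by rewrite divr_gt0 ?sqrtr_gt0.
move=> x sol; rewrite !enorm_lt ?divr_gt0 ?sqrtr_gt0 // => lt t t0.
rewrite expr_div_n sqr_sqrtr ?(ltW L0) // ltr_pdivlMr // in lt.
rewrite enorm_lt //; apply: le_lt_trans lt.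
rewrite -[x t](mulKmx Q_unit); apply: le_trans (boundi _) _.
have b := trajectory_bounded swP s0 dwell sol (ltW t0).
have b' := boundQ (x 0).
apply: (@le_trans _ _ (Ki * ((K1 + K2 * K1) * (K * sqnorm (x 0))))).
  rewrite ler_pM2l //; apply: le_trans b _.
  by rewrite ler_wpM2l.
by rewrite !mulrA [leRHS]mulrC ler_wpM2r ?sqnorm_ge0 // -!mulrA lerDl.
Qed.

Lemma contracts_asymptotically_stable sigma : sigma \in signals' tau eta ->
  asymptotically_stable A1 A2 sigma.
Proof.
move=> sig; move: (sig); rewrite inE => -[sw [swP s0 dwell ncvg]].
split; first by apply: contracts_stable; rewrite inE; exists sw.
move=> x sol; apply/cvgrPdist_lt => e e0.
have [Ki Ki0 boundi] := sqnorm_mul_le (invmx Q).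
have p0 : 0 < e ^+ 2 / Ki by rewrite divr_gt0 ?exprn_gt0.
have [M HM] := trajectory_vanishes swP s0 dwell sol p0 ncvg.
exists M; split; first exact: num_real.
move=> t Mt; rewrite sub0r normrN ger0_norm; last by rewrite enormE sqrtr_ge0.
rewrite enorm_lt // -[x t](mulKmx Q_unit); apply: le_lt_trans (boundi _) _.
by rewrite mulrC -ltr_pdivlMr // HM // ltW.
Qed.

End stability.

(** * The planar pair: a Jordan block and a diagonal matrix *)

Lemma det_mx2 (R : realType) (a b c d : R) : \det (mx2 a b c d) = a * d - b * c.
Proof.
rewrite (expand_det_row _ ord0) !big_ord_recl big_ord0 addr0 /cofactor.
by rewrite !det_mx11 !mxE /= expr0 expr1; ring.
Qed.

Lemma shear_flow_bounded (R : realType) (n al be ga : R) : 0 < n ->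
  exists2 K, 0 <= K & forall t z, 0 <= t ->
    sqnorm (shear_flow n al be ga t *m z) <= K * sqnorm z.
Proof.
move=> n0.
have k0 : 0 <= 4 * al ^+ 2 + be ^+ 2 + ga ^+ 2.
  by have := sqr_ge0 al; have := sqr_ge0 be; have := sqr_ge0 ga; lra.
exists (4 + (4 * al ^+ 2 + be ^+ 2 + ga ^+ 2) / n ^+ 2).
  by rewrite addr_ge0 // divr_ge0 ?sqr_ge0.
move=> t z t0; rewrite /shear_flow -scalemxAl sqnormZ; set e := expR _.
have e0 : 0 <= e := expR_ge0 _.
have e1 : e <= 1 by rewrite -expR0 ler_expR mulNr oppr_le0 mulr_ge0 // ltW.
have ent : e * (n * t) <= 1.
  have h := expR_ge1Dx (n * t).
  have : e * expR (n * t) = 1 by rewrite -expRD mulNr addNr expR0.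
  nra.
have w0 : 0 <= e * t by rewrite mulr_ge0.
have wn : (e * t) ^+ 2 <= (n ^+ 2)^-1.
  rewrite -exprVn ler_pXn2r ?nnegrE ?invr_ge0 ?(ltW n0) //.
  by rewrite -(ler_pM2l n0) divff ?gt_eqF //; lra.
apply: (@le_trans _ _ (e ^+ 2 * (((1 - al * t) ^+ 2 + (be * t) ^+ 2 +
   (- ga * t) ^+ 2 + (1 + al * t) ^+ 2) * sqnorm z))).
  by rewrite ler_wpM2l ?sqr_ge0 // sqnorm_mx2_le.
rewrite mulrA ler_wpM2r ?sqnorm_ge0 //.
have := ler_wpM2l k0 wn.
have e2 : e ^+ 2 <= 1 by rewrite exprn_ile1.
have s1 : 0 <= (al * (e * t)) ^+ 2 by exact: sqr_ge0.
by lra.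
Qed.

(** The nilpotent part of [J1] becomes, in the coordinates of [J2], the product
    of the column [(a, c)] by the row [(- c, a)] because the determinant is 1;
    [diag(k, 1)] commutes with [J2] and only rescales its off-diagonal
    entries. *)
Lemma shear_flow_solution (R : realType) (n a b c d k : R) (P1 P2 A : 'M[R]_2) :
  0 < k -> P1 \in unitmx -> P2 \in unitmx ->
  A = P1 *m mx2 (- n) 1 0 (- n) *m invmx P1 -> invmx P2 *m P1 = mx2 a b c d ->
  \det (mx2 a b c d) = 1 ->
  forall r s x, r <= s -> segment_solution A r s x ->
  mx2 k 0 0 1 *m invmx P2 *m x s =
  shear_flow n (a * c) (a ^+ 2 * k) (c ^+ 2 / k) (s - r) *m
    (mx2 k 0 0 1 *m invmx P2 *m x r).
Proof.
move=> k0 P1u P2u AE ME; rewrite det_mx2 => det1 r s x rs sol.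
have LA : invmx P1 *m A = mx2 (- n) 1 0 (- n) *m invmx P1.
  by rewrite AE !mulmxA mulVmx // mul1mx.
have coord t : mx2 k 0 0 1 *m invmx P2 *m x t =
    mx2 k 0 0 1 *m mx2 a b c d *m (invmx P1 *m x t).
  by rewrite -ME -!mulmxA (mulmxA P1) mulmxV // mul1mx.
rewrite !coord (jordan_flow_solution rs LA sol) /shear_flow.
rewrite -!scalemxAl -scalemxAr !mulmxA; congr (_ *: (_ *m _ *m _)).
rewrite !mx2_mul; set t := s - r.
have da : a * d = 1 + b * c by rewrite -det1; ring.
congr mx2.
- by ring.
- transitivity (k * (b + a * t * (a * d - b * c))); first by rewrite det1; ring.
  by ring.
- by field; rewrite gt_eqF.
- transitivity (d + c * t * (a * d - b * c)); first by rewrite det1; ring.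
  by field; rewrite gt_eqF.
Qed.

Lemma contracts_signals (R : realType) (n1 p2 q2 a b c d eta tau k : R)
  (P1 P2 A1 A2 : 'M[R]_2) :
  0 < n1 -> p2 <= q2 -> 0 < q2 -> 0 < k -> 0 <= tau ->
  P1 \in unitmx -> P2 \in unitmx ->
  A1 = P1 *m mx2 (- n1) 1 0 (- n1) *m invmx P1 ->
  A2 = P2 *m mx2 p2 0 0 q2 *m invmx P2 ->
  invmx P2 *m P1 = mx2 a b c d -> \det (mx2 a b c d) = 1 ->
  contracts (shear_flow n1 (a * c) (a ^+ 2 * k) (c ^+ 2 / k))
    (diag_flow p2 q2) tau eta ->
  (forall sigma, sigma \in signals tau eta -> stable A1 A2 sigma) /\
  (forall sigma, sigma \in signals' tau eta ->
     asymptotically_stable A1 A2 sigma).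
Proof.
move=> n0 pq q0 k0 tau0 P1u P2u A1E A2E ME detM ctr.
pose Q := mx2 k 0 0 1 *m invmx P2.
have Qu : Q \in unitmx.
  by rewrite unitmx_mul unitmx_inv P2u andbT unitmxE det_mx2 unitfE; lra.
have flow1 := shear_flow_solution k0 P1u P2u A1E ME detM.
have flow2 r s x : r <= s -> segment_solution A2 r s x ->
    Q *m x s = diag_flow p2 q2 (s - r) *m (Q *m x r).
  move=> rs; apply: diag_flow_solution rs _.
  rewrite A2E /Q -!mulmxA (mulmxA (invmx P2) P2) mulVmx // mul1mx !mulmxA.
  by congr (_ *m _); rewrite !mx2_mul; congr mx2; ring.
have [K K0 bB] := shear_flow_bounded (a * c) (a ^+ 2 * k) (c ^+ 2 / k) n0.
have bD s z : 0 <= s <= eta ->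
    sqnorm (diag_flow p2 q2 s *m z) <= expR (2 * (q2 * eta)) * sqnorm z.
  exact: sqnorm_diag_flow_le.
split=> sigma.
  exact: (contracts_stable Qu tau0 flow1 flow2 K0 (expR_ge0 _) bB bD ctr).
exact: (contracts_asymptotically_stable Qu tau0 flow1 flow2 K0 (expR_ge0 _)
  bB bD ctr).
Qed.

Theorem theorem10p3 (R : realType) (n1 p2 q2 a b c d eta eps0 : R)
  (P1 P2 A1 A2 : 'M[R]_2)
  (n1_gt0 : 0 < n1)
  (p2q2 : 0 < p2 <= q2 \/ p2 <= 0 < q2)
  (P1_unit : P1 \in unitmx) (P2_unit : P2 \in unitmx)
  (A1E : A1 = P1 *m mx2 (- n1) 1 0 (- n1) *m invmx P1)
  (A2E : A2 = P2 *m mx2 p2 0 0 q2 *m invmx P2)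
  (ME : invmx P2 *m P1 = mx2 a b c d)
  (detM : \det (mx2 a b c d) = 1)
  (eta_gt0 : 0 < eta) (eps0_gt0 : 0 < eps0) :
  (exists tau, is_tau21 n1 p2 q2 (a * c) eta eps0 tau) /\
  forall tau, is_tau21 n1 p2 q2 (a * c) eta eps0 tau ->
    (forall sigma, sigma \in signals tau eta -> stable A1 A2 sigma) /\
    (forall sigma, sigma \in signals' tau eta ->
       asymptotically_stable A1 A2 sigma).
Proof.
have q0 : 0 < q2 by case: p2q2; lra.
have pq : p2 <= q2 by case: p2q2; lra.
have [ac0|ac0] := eqVneq (a * c) 0.
  split; first by exists (q2 / n1 * eta + eps0); rewrite /is_tau21 ac0 eqxx.
  move=> tau; rewrite /is_tau21 ac0 eqxx => tauE.
  have tau0 : 0 < tau.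
    by rewrite tauE addr_gt0 // mulr_gt0 // divr_gt0.
  pose eps := Num.min (n1 / 2) (n1 * eps0 / (2 * tau)).
  have eps_gt0 : 0 < eps by rewrite lt_min !divr_gt0 ?mulr_gt0.
  (* The nilpotent part has a single nonzero entry, which is scaled to [eps]. *)
  have [k k0 small] : exists2 k, 0 < k & [/\ 0 <= a ^+ 2 * k <= eps,
      0 <= c ^+ 2 / k <= eps & a ^+ 2 * k * (c ^+ 2 / k) = 0].
    have det1 : a * d - b * c = 1 by rewrite -detM det_mx2.
    move/eqP: ac0; rewrite mulf_eq0 => /orP[/eqP a0|/eqP c0].
      have c2 : 0 < c ^+ 2.
        rewrite lt_neqAle sqr_ge0 andbT eq_sym sqrf_eq0; apply/eqP => c0.
        by move: det1; rewrite a0 c0; lra.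
      exists (c ^+ 2 / eps); first by rewrite divr_gt0.
      rewrite a0 expr0n /= !mul0r; split=> //; first by rewrite lexx ltW.
      by rewrite invf_div mulrC divfK ?gt_eqF // lexx ltW.
    have a2 : 0 < a ^+ 2.
      rewrite lt_neqAle sqr_ge0 andbT eq_sym sqrf_eq0; apply/eqP => a0.
      by move: det1; rewrite a0 c0; lra.
    exists (eps / a ^+ 2); first by rewrite divr_gt0.
    rewrite c0 expr0n /= !mul0r mulr0; split=> //; last by rewrite lexx ltW.
    by rewrite mulrC divfK ?gt_eqF // lexx ltW.
  case: small => small_a small_c ac_small.
  apply: (contracts_signals n1_gt0 pq q0 k0 (ltW tau0) P1_unit P2_unit A1E A2E
    ME detM).
  rewrite ac0; apply: (strict_shear_contracts n1_gt0 pq q0 eta_gt0 eps0_gt0 tauE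
    small_a small_c ac_small).
    by rewrite /eps ge_min lexx.
  have : eps <= n1 * eps0 / (2 * tau) by rewrite /eps ge_min lexx orbT.
  by rewrite ler_pdivlMr ?mulr_gt0 //; lra.
split; first exact: (tau21_ex _ n1_gt0 p2q2 ac0 eta_gt0 erefl).
move=> tau /(tau21_margin n1_gt0 p2q2 ac0 eta_gt0 erefl) margin.
set m := _ / 2 * eta in margin; set C := _ / 2 * eta in margin.
have a0 : a != 0 by move: ac0; rewrite mulf_eq0 negb_or => /andP[].
have c0 : c != 0 by move: ac0; rewrite mulf_eq0 negb_or => /andP[].
have tau0 : 0 < tau by case: margin.
(* This scaling gives the off-diagonal entries [`|ac| * expR m] and
   [`|ac| * expR (- m)] that [margin_contracts] asks for. *)
have k0 : 0 < `|c| / `|a| * expR m.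
  by rewrite mulr_gt0 ?expR_gt0 ?divr_gt0 ?normr_gt0.
apply: (contracts_signals n1_gt0 pq q0 k0 (ltW tau0) P1_unit P2_unit A1E A2E
    ME detM).
have -> : a ^+ 2 * (`|c| / `|a| * expR m) = `|a * c| * expR m.
  by rewrite -(real_normK (num_real a)) normrM; field; rewrite normr_eq0.
have -> : c ^+ 2 / (`|c| / `|a| * expR m) = `|a * c| * expR (- m).
  rewrite -(real_normK (num_real c)) normrM expRN; field.
  by rewrite !normr_eq0 a0 c0 expR_eq0.
have CmE : C - m = Num.max 0 p2 * eta by rewrite /C /m; field.
apply: (margin_contracts ac0 q0 _ _ _ margin).
- by rewrite CmE mulr_ge0 ?le_max ?lexx // ltW.
- by rewrite CmE ler_pM2r // le_max lexx orbT.
- by rewrite /C /m; field.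
Qed.
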